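(* Suppose $\beta_1,\beta_2>0$ and $\beta_1-\beta_2>0$. For fixed $t>0$, we have a.s., for all $x,x_1,x_2\in\mathbb{R}$, $$\left.\frac{d}{dy}X^y_t\right|_{y=x}=\exp\big(-2L^x_t(\beta_1-\beta_2)/\sigma^2\big),$$ and $$X^{x_2}_t-X^{x_1}_t=\int_{x_1}^{x_2}\exp\big(-2L^x_t(\beta_1-\beta_2)/\sigma^2\big)\,dx.$$
   Context: $\{B_t,t\in\mathbb{R}\}$ is a two-sided Brownian motion with $B_0=0$ and variance $\mathbb{E}B_t^2=\sigma^2|t|$, $\sigma^2>0$. For $x\in\mathbb{R}$, $X^x_t$ is the (a.s. unique) Lipschitz solution of $dX_t/dt=\beta_1$ if $X_t<B_t$, $dX_t/dt=\beta_2$ if $X_t>B_t$, with $X^x_0=x$. $L^x_t$, $t\ge 0$, denotes the local time at $0$ of the process $B_s-X^x_s$ accumulated on $[0,t]$, in a version jointly continuous in $(x,t)$. It is normalized so that its associated excursion laws for excursions of $B-X^x$ above (resp. below) $0$ are $\lim_{y\downarrow0}|y|^{-1}Q^y_{-\beta_1}$ (resp. $\lim_{y\uparrow0}|y|^{-1}Q^y_{-\beta_2}$), where $Q^y_\mu$ is the law of Brownian motion (infinitesimal variance $\sigma^2$) with drift $\mu$ started at $y$ and killed on hitting $0$. Equivalently, $L^x_t=\lim_{\varepsilon\downarrow0}\frac{\sigma^2}{4\varepsilon}\int_0^t\mathbf 1_{\{|B_s-X^x_s|\le\varepsilon\}}ds$, i.e. half of the usual semimartingale local time at $0$ of $B-X^x$.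 *)

(* Defs.v *)
From HB Require Import structures.
From mathcomp Require Import all_boot all_order all_algebra.
From mathcomp Require Import all_classical all_reals all_analysis.

Set Implicit Arguments.
Unset Strict Implicit.
Unset Printing Implicit Defensive.

Import Order.TTheory GRing.Theory Num.Theory.
Import numFieldNormedType.Exports.

Local Open Scope classical_set_scope.
Local Open Scope ring_scope.

Definition independent_increments (d : measure_display) (Omega : measurableType d)
    (R : realType) (P : probability Omega R) (B : R -> {RV P >-> R}) : Prop :=
  forall (n : nat) (t : nat -> R) (A : nat -> set R),
    (forall i, t i <= t i.+1) -> (forall i, measurable (A i)) ->
    P (\bigcap_(i < n) [set w | A i (B (t i.+1) w - B (t i) w)]) =
    (\prod_(i < n) P [set w | A i (B (t i.+1) w - B (t i) w)%R])%E.

(* [normal_prob m s] takes the standard deviation [s], not the variance; the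
   parameter [v] below is the infinitesimal variance. *)
Definition two_sided_brownian_motion (d : measure_display)
    (Omega : measurableType d) (R : realType) (P : probability Omega R)
    (v : R) (B : R -> {RV P >-> R}) : Prop :=
  [/\ \forall w \ae P, B 0 w = 0,
      \forall w \ae P, continuous (fun t : R => B t w),
      independent_increments B &
      forall s t : R, s < t -> forall A : set R, measurable A ->
        P [set w | A (B t w - B s w)] =
        normal_prob 0 (Num.sqrt (v * (t - s))) A].

(* The slope of [f] is prescribed only off the set of times where [f] meets [b],
   and time runs over the whole line. *)
Definition lipschitz_solution (R : realType) (beta1 beta2 : R) (b : R -> R)
    (x : R) (f : R -> R) : Prop :=
  [/\ lipschitz f,
      f 0 = x,
      forall t : R, f t < b t -> is_derive t (1 : R) f beta1 &
      forall t : R, b t < f t -> is_derive t (1 : R) f beta2].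

Definition solution_flow (d : measure_display) (Omega : measurableType d)
    (R : realType) (P : probability Omega R) (beta1 beta2 : R)
    (B : R -> {RV P >-> R}) (X : R -> R -> Omega -> R) : Prop :=
  \forall w \ae P, forall x : R,
    lipschitz_solution beta1 beta2 (fun t => B t w) x (fun t => X x t w).

(* With the factor [v / (4 eps)] the limit as [eps] tends to 0 is half of the
   semimartingale local time at 0 of [b - f]. *)
Definition normalized_occupation (R : realType) (v : R) (b f : R -> R)
    (t eps : R) : R :=
  v / (4 * eps) *
    \int[lebesgue_measure]_(s in `[0, t])
      \1_[set u | `|b u - f u| <= eps] s.

(* The first clause determines [L x t] up to a null set depending on [(x, t)];
   the second one selects the jointly continuous version. *)
Definition continuous_local_time (d : measure_display)
    (Omega : measurableType d) (R : realType) (P : probability Omega R)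
    (v : R) (B : R -> {RV P >-> R}) (X L : R -> R -> Omega -> R) : Prop :=
  (forall x t : R, 0 <= t ->
     \forall w \ae P,
       normalized_occupation v (fun s => B s w) (fun s => X x s w) t eps
         @[eps --> 0^'+] --> L x t w) /\
  (\forall w \ae P,
     {within [set p : R * R | 0 <= p.2],
       continuous (fun p : R * R => L p.1 p.2 w)}).

Definition oriented_integral (R : realType) (a b : R) (f : R -> R) : R :=
  if a <= b then \int[lebesgue_measure]_(x in `[a, b]) f x
  else - \int[lebesgue_measure]_(x in `[b, a]) f x.

(* Main.v *)
(* For [s >= 0] the flow [x |-> X^x_s] is nondecreasing and 1-Lipschitz, and the
   distance of two solutions decreases at rate [D = beta1 - beta2] exactly while
   [B] runs between them. Fix [x] at which all maps [y |-> X^y_r], [r] in a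
   countable set of times, are differentiable, with derivatives [u r]. Up to
   factors close to 1, [|B_s - X^x_s| <= eps] means that [B_s] lies between
   [X^(x - h)_s] and [X^(x + h)_s] with [h = eps / u s], so the occupation time
   of this tube during [[r, r']] is about [2 h (u r - u r') / D]. Letting [eps]
   tend to 0, [u r - u r'] lies between [c u r' dL] and [c u r dL], where
   [c = 2 D / sigma^2] and [dL] is the increment of the local time; refining the
   partition gives [u t = exp (- c L^x_t)].

   This applies to almost every [x]: differentiability holds almost everywhere,
   and the occupation limits, known almost surely for each fixed [x], hold almost
   surely for almost every [x] by Tonelli. Limits at countably many [x] would not
   be enough, so the joint measurability of the flow is really used; it comes
   from an Euler scheme. The integral formula then follows from the
   differentiation theorem for Lipschitz functions, and the derivative at every
   [x] from the continuity of [L] in [x].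

   Finally, a Lipschitz function coincides with [B] on a null set of times only,
   since the increments of [B] over a time [h] are of order [sqrt h]. *)

Require Import Defs.
From HB Require Import structures.
From mathcomp Require Import all_boot all_order all_algebra.
From mathcomp Require Import all_classical all_reals all_analysis.
From mathcomp Require Import measurable_realfun.
From mathcomp Require Import ring lra.

Set Implicit Arguments.
Unset Strict Implicit.
Unset Printing Implicit Defensive.
Set SsrOldRewriteGoalsOrder.

Import Order.TTheory GRing.Theory Num.Theory.
Import numFieldNormedType.Exports.

Local Open Scope classical_set_scope.
Local Open Scope ring_scope.

(** * Lipschitz functions as integrals of their derivatives *)

Section lipschitz_ftc.
Context {R : realType}.
Local Notation mu := (@lebesgue_measure R).

Definition lip (K : R) (f : R -> R) :=
  forall x y, `|f x - f y| <= K * `|x - y|.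

Lemma lip_continuous (K : R) (f : R -> R) : lip K f -> continuous f.
Proof.
move=> fL x; apply/(@cvgrPdist_le _ R^o) => e e0.
have K0 : 0 < `|K| + 1 by rewrite ltr_wpDl.
near=> y; apply: (le_trans (fL x y)).
apply: (@le_trans _ _ ((`|K| + 1) * `|x - y|)).
  by rewrite ler_wpM2r// (le_trans (ler_norm K))// lerDl.
rewrite mulrC -ler_pdivlMr//.
near: y; apply: (@cvgr_dist_le _ R^o); first exact: cvg_id.
by rewrite divr_gt0.
Unshelve. all: by end_near. Qed.

(** A null set has a cover by half-open intervals of total length below [e / K], and [G] gives this
    cover mass at most [e]. *)
Lemma stieltjes_dominates (G : cumulative R R) (K : R) : 0 < K ->
  (forall x y, x <= y -> G y - G x <= K * (y - x)) ->
  lebesgue_stieltjes_measure G `<< mu.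
Proof.
move=> K0 GK; apply/null_content_dominatesP => A mA A0.
apply/eqP; rewrite eq_le measure_ge0 andbT.
apply/lee_addgt0Pr => e e0; rewrite add0e.
have eK0 : 0 < e / K by rewrite divr_gt0.
have : ereal_inf [set (\sum_(0 <= k <oo) wlength idfun (F k))%E |
    F in @measurable_cover _ (ocitv_type R) A] = 0%E by exact: A0.
move=> I0.
have If : ereal_inf [set (\sum_(0 <= k <oo) wlength idfun (F k))%E |
    F in @measurable_cover _ (ocitv_type R) A] \is a fin_num by rewrite I0.
have [_ [F AF <-]] := lb_ereal_inf_adherent eK0 If; rewrite I0 add0e => Fe.
apply: (@le_trans _ _ (\sum_(0 <= k <oo) wlength G (F k))%E).
  by apply: ereal_inf_lbound; exists F.
apply: (@le_trans _ _ (\sum_(0 <= k <oo) (K%:E * wlength idfun (F k)))%E).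
  apply: lee_nneseries => [k _ _|k _]; first exact: wlength_ge0.
  have [/= /(_ k) + _] := AF.
  move=> /ocitvP[->|[[x y]/= xy ->]]; first by rewrite !wlength0 mule0.
  have xy' := ltW xy.
  by rewrite !wlength_itv_bnd//= -EFinM lee_fin; exact: GK.
rewrite nneseriesZl//.
by have := ltW Fe; rewrite mulrC EFinM lee_pdivlMl.
Qed.

(** Adding the slope [K] makes [f] nondecreasing, so it has a Stieltjes measure, absolutely
    continuous because [f] is Lipschitz. Its Radon-Nikodym density minus [K] is [rho], and Lebesgue
    differentiation identifies [rho] with the derivative almost everywhere. *)
Lemma lip_FTC (K : R) (f : R -> R) (a b : R) : 0 < K -> lip K f -> a < b ->
  exists rho : R -> R,
    [/\ mu.-integrable `[a, b] (EFin \o rho),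
      (forall x, a <= x <= b -> f x - f a = \int[mu]_(s in `[a, x]) rho s) &
      {ae mu, forall x, a < x < b -> is_derive x (1 : R) f (rho x)}].
Proof.
move=> K0 fL ab.
pose g x := f x + K * x.
have gnd : {homo g : x y / x <= y}.
  move=> x y xy; rewrite /g.
  have := fL x y; rewrite (ler0_norm (x := x - y)) ?subr_le0// => /ler_normlW.
  by rewrite mulrN mulrBr; lra.
have gc : continuous g.
  move=> x; apply: cvgD; first exact: (lip_continuous fL).
  by apply: cvgM; [exact: cvg_cst|exact: cvg_id].
have gcr := right_continuousW gc.
pose G : cumulative R R :=
  HB.pack g (isCumulative.Build R _ R g gnd gcr).
have GK x y : x <= y -> G y - G x <= (2 * K) * (y - x).
  move=> xy; rewrite /= /g.
  have := fL y x; rewrite (ger0_norm (x := y - x)) ?subr_ge0// => /ler_normlW.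
  by rewrite mulrBr; lra.
have K20 : 0 < 2 * K by rewrite mulr_gt0.
have dom := stieltjes_dominates K20 GK.
have SE x y : x <= y -> lebesgue_stieltjes_measure G `]x, y] = (G y - G x)%:E.
  move=> xy; rewrite /lebesgue_stieltjes_measure/= /measure_extension.
  rewrite (@measurable_mu_extE _ _ _ (wlength G))/=; last exact: is_ocitv.
  by rewrite wlength_itv_bnd.
pose c := b + 1.
have ac : a < c by rewrite /c ltr_wpDr.
have mD : measurable (`]a, c]%classic : set (measurableTypeR R)) by [].
have Doo : (lebesgue_stieltjes_measure G `]a, c]%classic < +oo)%E.
  by rewrite SE ?ltW// ltry.
(* Restriction to a bounded interval provides the finite measure that Radon-Nikodym is applied
   to. *)
pose nu : {finite_measure set (measurableTypeR R) -> \bar R} := mfrestr mD Doo.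
have nudom : nu `<< mu.
  apply/null_content_dominatesP => A mA A0.
  apply/eqP; rewrite eq_le measure_ge0 andbT.
  apply: (@le_trans _ _ (lebesgue_stieltjes_measure G A)).
    by apply: le_measure; rewrite ?inE//; exact: measurableI.
  by rewrite ((null_content_dominatesP _ _).1 dom A mA A0).
have [h [h0 hfin hi nuE]] := radon_nikodym_sigma_finite nudom.
pose r : R -> R := fine \o h.
have hE : h = EFin \o r by apply/funext => x; rewrite /r/= fineK.
have ri : mu.-integrable setT (EFin \o r) by rewrite -hE.
have rI x : a <= x <= c -> g x - g a = \int[mu]_(s in `[a, x]) r s.
  move=> /andP[ax xc].
  apply: EFin_inj; rewrite /Rintegral fineK; last first.
    by apply: integrable_fin_num => //; exact: integrableS ri.
  rewrite -integral_itv_obnd_cbnd; last first.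
    apply/measurable_EFinP/measurable_funTS.
    by case/integrableP : ri => /measurable_EFinP.
  rewrite (_ : (fun s => (r s)%:E) = h)//.
  rewrite -nuE//.
  rewrite /= /mfrestr /mrestr -SE//; congr (lebesgue_stieltjes_measure _ _).
  rewrite setIidl// => z; rewrite /= !in_itv/= => /andP[-> zx].
  by rewrite (le_trans zx).
have locr : locally_integrable setT r.
  by apply: open_integrable_locally => //; exact: openT.
have riy y : mu.-integrable [set` Interval (BLeft a) (BRight y)] (EFin \o r).
  exact: integrableS ri.
pose F (y : R) : R := \int[mu]_(s in `[a, y]) r s.
have Fd := FTC1 riy locr. 
exists (fun x => r x - K); split.
- rewrite (_ : _ \o _ = (fun x => (EFin \o r) x - (EFin \o cst K) x)%E)//.
  apply: integrableB => //.
  apply: continuous_compact_integrable; first exact: segment_compact.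
  by apply: continuous_subspaceT => z; exact: cvg_cst.
- move=> x /andP[ax xb]; rewrite RintegralB//; last first.
    apply: continuous_compact_integrable; first exact: segment_compact.
    by apply: continuous_subspaceT => z; exact: cvg_cst.
  rewrite Rintegral_cst//= lebesgue_measure_itv/= lte_fin.
  rewrite -rI; last by rewrite ax (le_trans xb)// /c lerDl.
  rewrite /g; case: ltP => [_|xa]/=; first by rewrite mulrBr; lra.
  have -> : x = a by apply/eqP; rewrite eq_le ax xa.
  lra.
- move: Fd; apply: filterS; first exact: (ae_filter_ringOfSetsType mu).
  move=> x + /andP[ax xb]; rewrite lte_fin => /(_ ax)[Fdx F'x].
  have dF : is_derive x (1 : R) F (r x) by apply: DeriveDef => //; rewrite -derive1E.
  have dF2 : is_derive x (1 : R) (fun y => F y + (g a - K * y)) (r x - K).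
    apply: is_deriveD.
    rewrite -[- K]add0r; apply: is_deriveB.
    by rewrite -[X in is_derive _ _ _ X]mulr1; apply: is_deriveZ.
  apply: near_eq_is_derive dF2.
  near=> y; rewrite /F -rI /g; first by lra.
  rewrite ltW ?ltW//=.
    near: y; apply: lt_nbhsl; rewrite /c; lra.
  by near: y; apply: lt_nbhsr.
Unshelve. all: by end_near. Qed.

End lipschitz_ftc.

(** * Lipschitz functions controlled by their slope at almost every point *)

Section lipschitz_ae.
Context {R : realType}.
Local Notation mu := (@lebesgue_measure R).

Lemma ae_lebesgueS (P Q : R -> Prop) : (forall x, P x -> Q x) ->
  {ae mu, forall x, P x} -> {ae mu, forall x, Q x}.
Proof.
by move=> PQ; apply: filterS => //; exact: (ae_filter_ringOfSetsType mu).
Qed.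

Lemma ae_lebesgueI (P Q : R -> Prop) :
  {ae mu, forall x, P x} -> {ae mu, forall x, Q x} ->
  {ae mu, forall x, P x /\ Q x}.
Proof.
by move=> aP aQ; apply: filterI => //; exact: (ae_filter_ringOfSetsType mu).
Qed.

Lemma ae_neq (a : R) : {ae mu, forall x : R, x != a}.
Proof.
exists [set a]; split => //; first exact: lebesgue_measure_set1.
by move=> x /= /negP; rewrite negbK => /eqP.
Qed.

Lemma ae_eq_Rintegral_itv (a b : R) (f g : R -> R) :
  measurable_fun `[a, b] f -> measurable_fun `[a, b] g ->
  {ae mu, forall x, a < x < b -> f x = g x} ->
  \int[mu]_(x in `[a, b]) f x = \int[mu]_(x in `[a, b]) g x.
Proof.
move=> mf mg fg; congr fine; apply: ae_eq_integral => //.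
- exact/measurable_EFinP.
- exact/measurable_EFinP.
- apply: ae_lebesgueS (ae_lebesgueI (ae_lebesgueI (ae_neq a) (ae_neq b)) fg).
  move=> x [[xa xb] fgx]; rewrite /= in_itv/= => /andP[ax xb'].
  by rewrite fgx// !lt_neqAle eq_sym xa xb ax xb'.
Qed.

Lemma integrable_itv_measurable (a b : R) (f : R -> R) :
  mu.-integrable `[a, b] (EFin \o f) -> measurable_fun `[a, b] f.
Proof. by case/integrableP => /measurable_EFinP. Qed.

Lemma lip_ae_integral (K : R) (f g : R -> R) (a b : R) :
  0 < K -> lip K f -> a <= b -> measurable_fun `[a, b] g ->
  {ae mu, forall s, a < s < b -> is_derive s (1 : R) f (g s)} ->
  f b - f a = \int[mu]_(s in `[a, b]) g s.
Proof.
move=> K0 fL; rewrite le_eqVlt => /predU1P[<- _ _|ab mg fg].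
  by rewrite set_itv1 Rintegral_set1 subrr.
have [rho [ri rE rd]] := lip_FTC K0 fL ab.
have lab := ltW ab; rewrite rE ?lexx ?lab//; apply: ae_eq_Rintegral_itv => //.
  exact: integrable_itv_measurable.
apply: ae_lebesgueS (ae_lebesgueI rd fg) => x [h1 h2] axb.
have [_ <-] := h1 axb; by have [_ <-] := h2 axb.
Qed.

Lemma integrable_cst_itv (a b c : R) :
  mu.-integrable `[a, b] (EFin \o cst c).
Proof.
apply: continuous_compact_integrable; first exact: segment_compact.
by apply: continuous_subspaceT => z; exact: cvg_cst.
Qed.

Lemma Rintegral_cst_itv (a b c : R) : a <= b ->
  \int[mu]_(s in `[a, b]) c = c * (b - a).
Proof.
move=> ab; rewrite Rintegral_cst//= lebesgue_measure_itv/= lte_fin.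
case: ltP => //= ba; suff -> : a = b by rewrite subrr.
by apply/eqP; rewrite eq_le ab.
Qed.

Lemma lip_ae_le (K : R) (f : R -> R) (a b c : R) :
  0 < K -> lip K f -> a <= b ->
  {ae mu, forall s, a < s < b ->
    exists2 v, v <= c & is_derive s (1 : R) f v} ->
  f b - f a <= c * (b - a).
Proof.
move=> K0 fL; rewrite le_eqVlt => /predU1P[<- _|ab fg].
  by rewrite !subrr mulr0.
have [rho [ri rE rd]] := lip_FTC K0 fL ab.
have lab := ltW ab; rewrite rE ?lexx ?lab// -Rintegral_cst_itv//.
have mr := integrable_itv_measurable ri.
(* The bound on [rho] holds only almost everywhere; the truncation satisfies it at every point and
   has the same integral. *)
rewrite (@ae_eq_Rintegral_itv _ _ rho (rho \min cst c))//; last 2 first.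
  exact: measurable_minr.
  apply: ae_lebesgueS (ae_lebesgueI rd fg) => x [h1 h2] axb.
  have [v vc [_ fv]] := h2 axb; have [_ rv] := h1 axb.
  have rc : rho x <= c by rewrite -rv fv.
  by rewrite /= min_l.
apply: le_Rintegral => //; last by move=> x _; rewrite /= ge_min lexx orbT.
- have ig : mu.-integrable `[a, b]
      (fun x => `|(EFin \o rho) x| + `|(EFin \o cst c) x|)%E.
    by apply: integrableD => //; apply: integrable_abse => //;
      exact: integrable_cst_itv.
  apply: (le_integrable _ _ _ ig) => //.
    by apply/measurable_EFinP; exact: measurable_minr.
  move=> x _ /=; rewrite lee_fin (ger0_norm (addr_ge0 _ _))//.
  by rewrite minEle; case: ifP => _; rewrite ?lerDl ?lerDr.
- exact: integrable_cst_itv.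
Qed.

Lemma lipN (K : R) (f : R -> R) : lip K f -> lip K (\- f).
Proof. by move=> fL x y /=; rewrite opprK addrC distrC fL. Qed.

Lemma lipD (K L : R) (f g : R -> R) : lip K f -> lip L g -> lip (K + L) (f \+ g).
Proof.
move=> fL gL x y /=; rewrite opprD addrACA mulrDl.
by rewrite (le_trans (ler_normD _ _))// lerD.
Qed.

Lemma lipB (K L : R) (f g : R -> R) : lip K f -> lip L g -> lip (K + L) (f \- g).
Proof. by move=> fL gL; exact: (lipD fL (lipN gL)). Qed.

Lemma lip_ae_ge (K : R) (f : R -> R) (a b c : R) :
  0 < K -> lip K f -> a <= b ->
  {ae mu, forall s, a < s < b ->
    exists2 v, c <= v & is_derive s (1 : R) f v} ->
  c * (b - a) <= f b - f a.
Proof.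
move=> K0 fL ab h.
have := @lip_ae_le K (\- f) a b (- c) K0 (lipN fL) ab; rewrite /=.
rewrite mulNr opprK addrC -[f a - _]opprB lerN2; apply.
apply: ae_lebesgueS h => s h /h [v cv dv].
by exists (- v); [rewrite lerN2|exact: is_deriveN].
Qed.

(* After the last time [e] was nonpositive, [e] cannot increase. *)
Lemma lip_ae_nonpos (K : R) (e : R -> R) (a b : R) :
  0 < K -> lip K e -> a <= b -> e a <= 0 ->
  {ae mu, forall s, a < s < b -> 0 < e s ->
    exists2 v, v <= 0 & is_derive s (1 : R) e v} ->
  e b <= 0.
Proof.
move=> K0 eL ab ea h; rewrite leNgt; apply/negP => eb.
pose A := [set s | a <= s <= b /\ e s <= 0].
have Aa : A a by split => //; rewrite lexx.
have Aub : has_ubound A by exists b => s [/andP[]].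
have hs : has_sup A by split; [exists a|].
have Acl : closed A.
  rewrite (_ : A = `[a, b]%classic `&` e @^-1` [set x | x <= 0]).
    apply: closedI; first exact: interval_closed.
    apply: closed_comp; last exact: (@closed_le _ 0).
    by move=> s _; exact: (lip_continuous eL).
  by apply/seteqP; split => s /=; rewrite in_itv.
have [/andP[a0 b0] e0] : A (sup A).
  by have := closure_sup hs.1 hs.2; rewrite -((closure_id A).1 Acl).
have h0 : e b - e (sup A) <= 0 * (b - sup A).
  apply: lip_ae_le K0 eL b0 _.
  apply: ae_lebesgueS h => s h /andP[s1 s2].
  apply: h; first by rewrite s2 (le_lt_trans a0).
  rewrite ltNge; apply/negP => es.
  have : s <= sup A.
    by apply: ub_le_sup => //; split => //; rewrite (ltW s2) (le_trans a0)// ltW.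
  by rewrite leNgt s1.
by move: h0; rewrite mul0r; lra.
Qed.

End lipschitz_ae.

Section heine.
Context {R : realType}.

(** Heine's theorem by compactness of the segment. Only [s] is confined to the segment; [s'] may lie
    outside. *)
Lemma itv_unif_continuous (f : R -> R) (a c e : R) : continuous f -> 0 < e ->
  exists2 delta : R, 0 < delta &
    forall s s', a <= s <= c -> `|s' - s| <= delta -> `|f s' - f s| <= e.
Proof.
move=> fc e0.
have e20 : 0 < e / 2 by rewrite divr_gt0.
pose P (delta s : R) := forall s', `|s' - s| <= delta -> `|f s' - f s| <= e.
have : \forall delta \near (0:R)^'+, `[a, c]%classic `<=` P delta.
  apply: (@compact_near_coveringP _ _).1; first exact: segment_compact.
  move=> x _.
  have /(_ (e / 2) e20) := (@cvgrPdist_le _ R^o _ _ (nbhs_filter x) f (f x)).1 (fc x).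
  move=> /nbhs_ballP[d /= d0 fd].
  have d20 : 0 < d / 2 by rewrite divr_gt0.
  near=> y delta; rewrite /P/= => s' s'y.
  have xs' : `|f x - f s'| <= e / 2.
    apply: fd; rewrite /ball/= [x - s'](_ : _ = (x - y) - (s' - y)); last by ring.
    rewrite (le_lt_trans (ler_normB _ _))// [d]splitr ltr_leD//.
      by apply: (le_trans s'y); near: delta; apply: nbhs_right_le.
  have xy : `|f x - f y| <= e / 2.
    apply: fd; rewrite /ball/= (@lt_le_trans _ _ (d / 2))//.
    by rewrite ler_pdivrMr// ler_peMr ?(ltW d0)// ler1n.
  rewrite [f s' - f y](_ : _ = (f x - f y) - (f x - f s')); last by ring.
  by rewrite (le_trans (ler_normB _ _))// [e]splitr lerD.
move=> H; near (0:R)^'+ => delta.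
exists delta => // s s' sac.
have : `[a, c]%classic `<=` P delta by near: delta.
by apply; rewrite /= in_itv.
Unshelve. all: by end_near. Qed.

End heine.

(** * Exponential decay from one-step estimates *)

Section exponential_decay.
Context {R : realType}.

Lemma ler_eps_mul (x y w : R) : 0 <= w ->
  (forall e, 0 < e -> e < 1 -> x <= y + e * w) -> x <= y.
Proof.
move=> w0 h; apply/ler_addgt0Pr => e e0.
pose d := Num.min (e / (w + 1)) (1 / 2).
have w1 : 0 < w + 1 by rewrite ltr_wpDl.
have d0 : 0 < d by rewrite lt_min !divr_gt0.
have d1 : d < 1 by rewrite gt_min; apply/orP; right; lra.
apply: (le_trans (h d d0 d1)); rewrite lerD2l.
apply: (@le_trans _ _ (e / (w + 1) * (w + 1))).
  by apply: ler_pM => //; rewrite ?(ltW d0)// ?ge_min ?lexx// lerDl.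
by rewrite divfK// gt_eqF.
Qed.

(* One step compares [u (k.+1) / u k] with [expR (- d)] up to a relative error
   [d ^+ 2], and these errors add up to at most [eta * a n]. *)
Lemma decay_bounds (eta : R) (a u : nat -> R) (n : nat) :
  0 < eta -> eta <= 1 -> a 0%N = 0 -> u 0%N = 1 ->
  (forall k, 0 <= u k) ->
  (forall k, (k < n)%N -> 0 <= a k.+1 - a k <= eta /\
    u k - u k.+1 <= (a k.+1 - a k) * u k /\
    (a k.+1 - a k) * u k.+1 <= u k - u k.+1) ->
  1 - eta * a n <= u n * expR (a n) /\
  u n * expR (a n) * (1 - eta * a n) <= 1.
Proof.
move=> eta0 eta1 a0 u0 upos; elim: n => [_|n IH h].
  by rewrite a0 u0 expR0 mulr0 subr0 !mulr1.
have [|IH1 IH2] := IH; first by move=> k kn; apply: h; rewrite ltnS ltnW.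
have [/andP[d0 d1] [s1 s2]] := h n (ltnSn n).
have an0 : 0 <= a n.
  suff: forall k, (k <= n)%N -> 0 <= a k by exact.
  elim=> [|k IHk kn]; first by rewrite a0.
  have [/andP[dk0 _] _] := h k (leq_trans kn (leqnSn n)).
  by have := IHk (ltnW kn); lra.
set d := a n.+1 - a n in d0 d1 s1 s2 *.
have -> : a n.+1 = a n + d by rewrite /d; ring.
rewrite expRD.
set v := u n * expR (a n) in IH1 IH2 *.
have v0 : 0 <= v by rewrite mulr_ge0// expR_ge0.
set w := u n.+1 * (expR (a n) * expR d).
have w0 : 0 <= w by rewrite !mulr_ge0// expR_ge0.
(* Combines [(1 - d) * u n <= u n.+1] with [1 + d <= expR d]; the loss is [d * d <= eta * d]. *)
have wlow : v * (1 - eta * d) <= w.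
  have /= ed := expR_ge1Dx d.
  have ea := expR_ge0 (a n).
  apply: (@le_trans _ _ (u n.+1 * (expR (a n) * (1 + d)))); last first.
    by rewrite /w; apply: ler_wpM2l => //; exact: ler_wpM2l.
  rewrite /v -!mulrA [X in X <= _]mulrCA [X in _ <= X]mulrCA.
  apply: ler_wpM2l => //.
  apply: (@le_trans _ _ (u n * (1 - d * d))).
    by apply: ler_wpM2l => //; rewrite lerD2l lerN2; exact: ler_wpM2r.
  rewrite (_ : 1 - d * d = (1 - d) * (1 + d)); last by ring.
  rewrite mulrA; apply: ler_wpM2r; first by rewrite addr_ge0.
  by rewrite mulrBr mulr1; move: s1; rewrite mulrC; lra.
(* Dually, [(1 + d) * u n.+1 <= u n] and [expR d * (1 - d) <= 1]. *)
have wup : w * (1 - eta * d) <= v.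
  have /= ed := expR_ge1Dx (- d).
  have ea := expR_ge0 (a n).
  have edd : expR d * (1 - d) <= 1.
    apply: (@le_trans _ _ (expR d * expR (- d))).
      by apply: ler_wpM2l; rewrite ?expR_ge0.
    by rewrite -expRD subrr expR0.
  apply: (@le_trans _ _ (w * (1 - d * d))).
    by apply: ler_wpM2l => //; rewrite lerD2l lerN2; exact: ler_wpM2r.
  have -> : w * (1 - d * d) =
      expR (a n) * ((u n.+1 * (1 + d)) * (expR d * (1 - d))) by rewrite /w; ring.
  rewrite /v mulrC [u n * _]mulrC mulrC; apply: ler_wpM2l => //.
  apply: (@le_trans _ _ (u n.+1 * (1 + d))).
    by apply: ler_piMr => //; rewrite mulr_ge0// addr_ge0.
  by rewrite mulrDr mulr1 mulrC; move: s2; rewrite mulrC; lra.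
have ed0 : 0 <= eta * d by rewrite mulr_ge0// ltW.
have ea0 : 0 <= eta * a n by rewrite mulr_ge0// ltW.
have eaed : 0 <= (eta * a n) * (eta * d) by rewrite mulr_ge0.
have ed1 : eta * d <= 1 by rewrite mulr_ile1// ?(ltW eta0)// (le_trans d1).
rewrite mulrDr; split.
  apply: le_trans wlow.
  apply: (@le_trans _ _ ((1 - eta * a n) * (1 - eta * d))).
    by lra.
  by apply: ler_wpM2r => //; rewrite subr_ge0.
have [neg|pos] := leP (1 - eta * a n) 0.
  apply: (@le_trans _ _ 0) => //; apply: mulr_ge0_le0 => //; lra.
apply: (@le_trans _ _ (w * ((1 - eta * a n) * (1 - eta * d)))).
  by apply: ler_wpM2l => //; lra.
apply: le_trans IH2.
by rewrite mulrCA [v * _]mulrC; apply: ler_wpM2l => //; exact: ltW.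
Qed.

(** On a grid so fine that [a] grows by at most [eta] per step, [decay_bounds] pins
    [u T * expR (a T)] to 1 up to an error proportional to [eta]. Continuity is asked of [a] only:
    nothing is known yet about the regularity of the derivative [u] in time. *)
Lemma decay_limit (T : R) (a u : R -> R) : 0 < T ->
  continuous a -> a 0 = 0 -> u 0 = 1 -> (forall r, 0 <= u r) ->
  (forall n k, (k < n)%N ->
    let r := T * k%:R / n%:R in let r' := T * k.+1%:R / n%:R in
    0 <= a r' - a r /\ u r - u r' <= (a r' - a r) * u r /\
    (a r' - a r) * u r' <= u r - u r') ->
  u T = expR (- a T).
Proof.
move=> T0 ac a0 u0 upos h.
have key eta : 0 < eta -> eta < 1 ->
    1 - eta * a T <= u T * expR (a T) /\
    u T * expR (a T) * (1 - eta * a T) <= 1.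
  move=> eta0 eta1.
  have [delta delta0 ad] := itv_unif_continuous 0 T ac eta0.
  pose n := (Num.bound (T / delta)).+1.
  have n0 : (0 < n%:R :> R) by rewrite ltr0n.
  have nT : T / n%:R <= delta.
    rewrite ler_pdivrMr// mulrC -ler_pdivrMr//.
    apply: (@le_trans _ _ (Num.bound (T / delta))%:R); last by rewrite ler_nat.
    by rewrite ltW// archi_boundP// divr_ge0// ltW.
  have := @decay_bounds eta (fun k => a (T * k%:R / n%:R))
    (fun k => u (T * k%:R / n%:R)) n eta0 (ltW eta1).
  rewrite /= mulfK ?gt_eqF// mulr0 mul0r; apply => // k kn.
  have [h1 h2] := h n k kn; split => //; rewrite h1/=.
  apply: le_trans (ler_norm _) _; apply: ad.
    rewrite divr_ge0 ?mulr_ge0 ?ler0n ?(ltW T0)//=.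
    by rewrite ler_pdivrMr// ler_pM2l// ler_nat ltnW.
  rewrite -mulrBl -mulrBr -natrB// subSnn mulr1 ger0_norm//.
  by rewrite divr_ge0// ltW.
have aT0 : 0 <= a T.
  have [h1 _] := h 1%N 0%N (ltnSn 0).
  by move: h1; rewrite /= mulr0 mul0r a0 subr0 mulr1 divr1.
suff E : u T * expR (a T) = 1.
  rewrite expRN; apply: (mulIf (lt0r_neq0 (expR_gt0 (a T)))).
  by rewrite E mulVf// lt0r_neq0// expR_gt0.
have v0 : 0 <= u T * expR (a T) by rewrite mulr_ge0// expR_ge0.
apply/eqP; rewrite eq_le; apply/andP; split.
  apply: (@ler_eps_mul _ _ (u T * expR (a T) * a T)); first exact: mulr_ge0.
  move=> e e0 e1; have [_] := key e e0 e1.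
  by rewrite mulrBr mulr1 mulrCA; lra.
apply: (@ler_eps_mul _ _ (a T)) => // e e0 e1.
by have [+ _] := key e e0 e1; lra.
Qed.

End exponential_decay.

(** * The flow of a fixed path *)

Section occupation.
Context {R : realType}.
Local Notation mu := (@lebesgue_measure R).

Definition occ (A : set R) (r r' : R) : R := \int[mu]_(s in `[r, r']) \1_A s.

Lemma integrable_indic_itv (A : set R) (a b : R) : measurable A ->
  mu.-integrable `[a, b] (EFin \o \1_A).
Proof.
move=> mA; apply: (le_integrable _ _ _ (integrable_cst_itv a b 1)) => //.
  by apply/measurable_EFinP/measurable_funTS; exact: measurable_indic.
by move=> x _ /=; rewrite lee_fin indicE; case: (_ \in _); rewrite ?normr1 ?normr0.
Qed.

Lemma le_occ (A B : set R) (r r' : R) : measurable A -> measurable B ->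
  (forall s, r <= s <= r' -> A s -> B s) -> occ A r r' <= occ B r r'.
Proof.
move=> mA mB AB; apply: le_Rintegral => //; try exact: integrable_indic_itv.
move=> s; rewrite /= in_itv/= => srr'; rewrite !indicE.
case: (boolP (s \in A)) => // /[!inE] As.
by rewrite mem_set//; exact: AB.
Qed.

Lemma occ_ge0 (A : set R) (r r' : R) : 0 <= occ A r r'.
Proof. by apply: Rintegral_ge0 => s _; rewrite indicE. Qed.

Lemma occB (A : set R) (r r' : R) : measurable A -> 0 <= r -> r <= r' ->
  occ A 0 r' - occ A 0 r = occ A r r'.
Proof.
move=> mA r0 rr'; rewrite /occ Rintegral_itvB//.
- rewrite Rintegral_itv_obnd_cbnd//.
  apply: integrableS (integrable_indic_itv r r' mA) => //.
  exact: subset_itv_oc_cc.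
- exact: integrable_indic_itv.
Qed.

End occupation.

Lemma derive_cvg_seq (R : realType) (f : R -> R) (x u : R) (h : R^nat) :
  is_derive x (1 : R) f u -> (forall n, h n != 0) -> h @ \oo --> (0 : R) ->
  (f (x + h n) - f x) / h n @[n --> \oo] --> u.
Proof.
move=> [df <-] h0 hc.
have hc' : h @ \oo --> (0 : R)^'.
  move=> A [d d0 dA]; suff : \forall n \near \oo, A (h n) by [].
  near=> n; apply: dA; last exact: h0.
  by near: n; exact: (@cvgr_dist_lt _ R^o _ _ _ _ _ hc).
have : (fun t : R => t^-1 *: (f (t *: (1 : R) + x) - f x)) (h n) @[n --> \oo]
    --> 'D_1 f x by apply: cvg_comp hc' df.
apply: cvg_trans; apply: near_eq_cvg; near=> n.
by rewrite /= /GRing.scale/= mulr1 (addrC (h n)) mulrC.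
Unshelve. all: by end_near. Qed.

(** Rademacher's theorem on the line, by exhausting it with bounded intervals to which [lip_FTC]
    applies. *)
Lemma lip_ae_derivable (R : realType) (K : R) (f : R -> R) : 0 < K -> lip K f ->
  {ae @lebesgue_measure R, forall x, derivable f x 1}.
Proof.
move=> K0 fL.
have H : {ae @lebesgue_measure R, forall x, forall n : nat,
    - n.+1%:R < x < n.+1%:R -> derivable f x 1}.
  apply: ae_foralln => n.
  have n0 : - n.+1%:R < n.+1%:R :> R by rewrite gtrN.
  have [rho [_ _ h]] := lip_FTC K0 fL n0.
  by apply: ae_lebesgueS h => x h /h[].
apply: ae_lebesgueS H => x h; apply: (h (Num.bound `|x|)).
rewrite -ltr_norml (@lt_le_trans _ _ (Num.bound `|x|)%:R)//.
  exact: archi_boundP.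
by rewrite ler_nat.
Qed.

Lemma is_derive_of_Rintegral (R : realType) (f g : R -> R) (x : R) :
  continuous g ->
  (forall x1 x2, x1 <= x2 ->
    f x2 - f x1 = \int[lebesgue_measure]_(s in `[x1, x2]) g s) ->
  is_derive x (1 : R) f (g x).
Proof.
move=> gc fE.
have xu : x < x + 1 by rewrite ltrDl.
have ax : x - 1 < x by rewrite gtrBl.
have gi : (@lebesgue_measure R).-integrable `[x - 1, x + 1] (EFin \o g).
  apply: continuous_compact_integrable; first exact: segment_compact.
  exact: continuous_subspaceT.
have [d dE] := continuous_FTC1_closed xu gi ax (gc x).
have dI : is_derive x (1 : R)
    (fun y => \int[lebesgue_measure]_(s in `[x - 1, y]) g s) (g x).
  by apply: DeriveDef => //; rewrite -derive1E.
have dI2 := is_deriveD dI (is_derive_cst (f (x - 1)) x 1).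
rewrite addr0 in dI2; apply: near_eq_is_derive dI2.
near=> y; rewrite /= -[LHS]/(_ + _) -fE ?subrK//.
by rewrite ltW//; near: y; exact: lt_nbhsr.
Unshelve. all: by end_near. Qed.

(** Each value depends measurably on finitely many values of [b], which makes the limiting flow
    measurable in the path. A tie with [b], where the equation prescribes no slope, gets [beta2]. *)
Fixpoint euler (R : realType) (beta1 beta2 : R) (b : R -> R) (h x : R) (n : nat) :
    R :=
  if n is m.+1 then
    let y := euler beta1 beta2 b h x m in
    y + (if y < b (m%:R * h) then beta1 else beta2) * h
  else x.

Section flow.
Context {R : realType}.
Local Notation mu := (@lebesgue_measure R).

Lemma lipschitz_lip (f : R -> R) : lipschitz f -> exists2 K, 0 < K & lip K f.
Proof.
move=> [M [_ /(_ (`|M| + 1))]] fM.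
exists (`|M| + 1); first by rewrite ltr_wpDl.
move=> x y; have := fM _ (x, y); apply => //.
by rewrite (le_lt_trans (ler_norm M))// ltrDl.
Qed.

Variables (beta1 beta2 T : R) (b : R -> R) (F : R -> R -> R).
Hypothesis beta2_gt0 : 0 < beta2.
Hypothesis beta_lt : beta2 < beta1.
Hypothesis bc : continuous b.
Hypothesis hF : forall x, lipschitz_solution beta1 beta2 b x (F x).
Hypothesis hnull : forall K f, lip K f ->
  {ae mu, forall s : R, 0 < s < T -> f s != b s}.

Lemma flow_lip x : exists2 K, 0 < K & lip K (F x).
Proof. by apply: lipschitz_lip; case: (hF x). Qed.

Lemma flow_cont x : continuous (F x).
Proof. by have [K _ KF] := flow_lip x; exact: lip_continuous KF. Qed.

Lemma flow0 x : F x 0 = x. Proof. by case: (hF x). Qed.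

(** By [hnull] the solution meets [b] on a null set of times only, so the slope is prescribed at
    almost every time. *)
Lemma flow_ae x : {ae mu, forall s : R, 0 < s < T ->
  (F x s < b s /\ is_derive s (1 : R) (F x) beta1) \/
  (b s < F x s /\ is_derive s (1 : R) (F x) beta2)}.
Proof.
have [K _ KF] := flow_lip x.
apply: ae_lebesgueS (hnull KF) => s h /h.
have [_ _ h1 h2] := hF x.
by case: ltgtP => // Fb _; [left|right]; split => //; [exact: h1|exact: h2].
Qed.

Lemma flow_ae_on x r r' : 0 <= r -> r' <= T -> {ae mu, forall s : R, r < s < r' ->
  (F x s < b s /\ is_derive s (1 : R) (F x) beta1) \/
  (b s < F x s /\ is_derive s (1 : R) (F x) beta2)}.
Proof.
move=> r0 rT; apply: ae_lebesgueS (flow_ae x) => s h /andP[rs sr].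
by apply: h; rewrite (le_lt_trans r0)// (lt_le_trans sr).
Qed.

Lemma flow_le x r r' : 0 <= r -> r <= r' -> r' <= T ->
  F x r' - F x r <= beta1 * (r' - r).
Proof.
move=> r0 rr rT; have [K K0 KF] := flow_lip x; apply: lip_ae_le K0 KF rr _.
apply: ae_lebesgueS (flow_ae_on x r0 rT) => s h /h[[_ d]|[_ d]].
  by exists beta1.
by exists beta2 => //; exact: ltW.
Qed.

Lemma flow_ge x r r' : 0 <= r -> r <= r' -> r' <= T ->
  beta2 * (r' - r) <= F x r' - F x r.
Proof.
move=> r0 rr rT; have [K K0 KF] := flow_lip x; apply: lip_ae_ge K0 KF rr _.
apply: ae_lebesgueS (flow_ae_on x r0 rT) => s h /h[[_ d]|[_ d]].
  by exists beta1 => //; exact: ltW.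
by exists beta2.
Qed.

Lemma flow_below x r r' : r <= r' -> (forall s, r < s < r' -> F x s < b s) ->
  F x r' - F x r = beta1 * (r' - r).
Proof.
move=> rr Fb; have [K K0 KF] := flow_lip x.
have [_ _ h1 _] := hF x.
apply/eqP; rewrite eq_le; apply/andP; split.
  apply: lip_ae_le K0 KF rr _.
  by apply: aeW => s srr; exists beta1 => //; apply: h1; exact: Fb.
apply: lip_ae_ge K0 KF rr _.
by apply: aeW => s srr; exists beta1 => //; apply: h1; exact: Fb.
Qed.

(** If [F x] were above [F y], then either both have the same slope or [b] separates them and [F x]
    has the smaller slope [beta2]. So a positive difference [F x - F y] never grows forwards in
    time. *)
Lemma flow_mono x y r : x <= y -> 0 <= r -> r <= T -> F x r <= F y r.
Proof.
move=> xy r0 rT; have [K K0 KF] := flow_lip x; have [L L0 LF] := flow_lip y.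
rewrite -subr_le0.
have := @lip_ae_nonpos R (K + L) (F x \- F y) 0 r; apply => //.
- by rewrite addr_gt0.
- exact: lipB.
- by rewrite /= !flow0 subr_le0.
apply: ae_lebesgueS (ae_lebesgueI (flow_ae_on x (lexx 0) rT) (flow_ae_on y (lexx 0) rT)).
move=> s [hx hy] sr; rewrite /= subr_gt0 => Fyx.
case: (hx sr) => -[bx dx]; case: (hy sr) => -[by_ dy].
- by exists (beta1 - beta1); [rewrite subrr|exact: is_deriveB].
- by have := lt_trans bx (lt_trans by_ Fyx); rewrite ltxx.
- by exists (beta2 - beta1); [rewrite subr_le0 ltW|exact: is_deriveB].
- by exists (beta2 - beta2); [rewrite subrr|exact: is_deriveB].
Qed.

Definition between (f g : R -> R) := [set s | f s < b s < g s].

Lemma open_between (f g : R -> R) : continuous f -> continuous g ->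
  open (between f g).
Proof.
move=> cf cg.
rewrite (_ : between f g = (b \- f) @^-1` [set x | 0 < x] `&`
                           (g \- b) @^-1` [set x | 0 < x]).
  by apply: openI; apply: open_comp => [s _|]; try exact: open_gt;
    apply: cvgB; (exact: bc || exact: cf || exact: cg).
apply/seteqP; split => s; rewrite /between /= !subr_gt0.
  by move=> /andP.
by move=> [-> ->].
Qed.

(** At almost every time the gap [F y - F x] has slope [beta2 - beta1] if [b] separates the two
    solutions and 0 otherwise; integrate this slope. *)
Lemma flow_occ x y r r' : x <= y -> 0 <= r -> r <= r' -> r' <= T ->
  (F y r - F x r) - (F y r' - F x r') =
  (beta1 - beta2) * occ (between (F x) (F y)) r r'.
Proof.
move=> xy r0 rr rT; have [K K0 KF] := flow_lip x; have [L L0 LF] := flow_lip y.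
have mV : measurable (between (F x) (F y)).
  by apply: open_measurable; apply: open_between; exact: flow_cont.
have KL0 : 0 < L + K by rewrite addr_gt0.
have E := @lip_ae_integral R (L + K) (F y \- F x)
  (fun s => (beta2 - beta1) * \1_(between (F x) (F y)) s) r r' KL0 (lipB LF KF) rr.
have -> : F y r - F x r - (F y r' - F x r') = - ((F y \- F x) r' - (F y \- F x) r).
  by rewrite /=; ring.
rewrite E.
- rewrite RintegralZl//; last exact: integrable_indic_itv.
  by rewrite -mulNr opprB.
- apply: measurable_funTS; apply: measurable_funM => //; exact: measurable_indic.
- apply: ae_lebesgueS (ae_lebesgueI (flow_ae_on x r0 rT) (flow_ae_on y r0 rT)).
  move=> s [hx hy] srr; have /andP[rs sr] := srr.
  have Fxy : F x s <= F y s.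
    apply: flow_mono => //; first by rewrite (le_trans r0)// ltW.
    by rewrite (le_trans _ rT)// ltW.
  rewrite indicE; case: (hx srr) => -[bx dx]; case: (hy srr) => -[by_ dy].
  + rewrite memNset ?mulr0; last first.
      by rewrite /between/= => /andP[_ /lt_trans/(_ by_)]; rewrite ltxx.
    by rewrite -(subrr beta1); exact: is_deriveB.
  + rewrite mem_set ?mulr1; last by rewrite /between/= bx by_.
    exact: is_deriveB.
  + by have := lt_le_trans bx (le_trans Fxy (ltW by_)); rewrite ltxx.
  + rewrite memNset ?mulr0; last first.
      by rewrite /between/= => /andP[/lt_trans/(_ bx)]; rewrite ltxx.
    by rewrite -(subrr beta2); exact: is_deriveB.
Qed.

Lemma flow_contract x y r r' : x <= y -> 0 <= r -> r <= r' -> r' <= T ->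
  F y r' - F x r' <= F y r - F x r.
Proof.
move=> xy r0 rr rT; rewrite -subr_ge0 flow_occ//.
by rewrite mulr_ge0// ?occ_ge0// subr_ge0 ltW.
Qed.

Lemma flow_lip_init r : 0 <= r -> r <= T -> lip 1 (F ^~ r).
Proof.
move=> r0 rT; suff H x y : x <= y -> `|F x r - F y r| <= `|x - y|.
  move=> x y; rewrite mul1r; have [|/ltW] := leP x y; first exact: H.
  by rewrite distrC (distrC x); exact: H.
move=> xy; rewrite distrC (distrC x) !ger0_norm ?subr_ge0//; last exact: flow_mono.
by have := flow_contract xy (lexx 0) r0 rT; rewrite !flow0.
Qed.

Definition tube (x eps : R) := [set s | `|b s - F x s| <= eps].

Lemma measurable_tube x eps : measurable (tube x eps).
Proof.
apply: closed_measurable.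
rewrite (_ : tube x eps = (Num.norm \o (b \- F x)) @^-1` [set y | y <= eps])//.
apply: closed_comp; last exact: closed_le.
move=> s _; apply: continuous_comp; last exact: norm_continuous.
by apply: cvgB; [exact: bc|exact: flow_cont].
Qed.

Variable v : R.
Hypothesis v0 : 0 < v.

Lemma normalized_occupationB x eps r r' : 0 <= r -> r <= r' ->
  normalized_occupation v b (F x) r' eps - normalized_occupation v b (F x) r eps =
  v / (4 * eps) * occ (tube x eps) r r'.
Proof.
move=> r0 rr; rewrite -(occB _ r0 rr); last exact: measurable_tube.
by rewrite mulrBr.
Qed.

(** * Loss of derivative against gain of local time over one time step *)

Section step.
Variables (x r r' u u' l l' lam : R).
Hypotheses (r0 : 0 <= r) (rr : r <= r') (rT : r' <= T).
Hypothesis du : is_derive x (1 : R) (F ^~ r) u.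
Hypothesis du' : is_derive x (1 : R) (F ^~ r') u'.
Hypothesis hl :
  normalized_occupation v b (F x) r (n.+1%:R^-1) @[n --> \oo] --> l.
Hypothesis hl' :
  normalized_occupation v b (F x) r' (n.+1%:R^-1) @[n --> \oo] --> l'.
Hypothesis lam0 : 0 < lam.

(** The tube has half-width [n.+1%:R^-1] and is compared with the flow lines started at [x - h n]
    and [x + h n]. The ratio [lam] will be chosen just below [1 / u] or just above [1 / u']. *)
Let h (n : nat) : R := lam * n.+1%:R^-1.

Let h_gt0 n : 0 < h n.
Proof. by rewrite mulr_gt0. Qed.

Let h_cvg : h @ \oo --> (0 : R).
Proof.
rewrite -(mulr0 lam); apply: cvgM; first exact: cvg_cst.
exact: cvg_harmonic.
Qed.

Let quot (q : R) (n : nat) : R * R :=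
  ((F (x + h n) q - F x q) / h n, (F (x + - h n) q - F x q) / - h n).

Let quot_cvg q w : is_derive x (1 : R) (F ^~ q) w ->
  (quot q n).1 @[n --> \oo] --> w /\ (quot q n).2 @[n --> \oo] --> w.
Proof.
move=> dw; split.
  by apply: (derive_cvg_seq dw) => // n; rewrite gt_eqF.
apply: (@derive_cvg_seq _ _ _ _ (\- h) dw) => [n|].
  by rewrite oppr_eq0 gt_eqF.
by rewrite -oppr0; apply: cvgN.
Qed.

(** The normalized occupation between the two flow lines ([gapE]), rewritten with right and left
    difference quotients so that its limit can be read off. *)
Let gap (n : nat) : R := v * lam / (4 * (beta1 - beta2)) *
  ((quot r n).1 + (quot r n).2 - ((quot r' n).1 + (quot r' n).2)).

Let gap_cvg :
  gap @ \oo --> v * lam / (4 * (beta1 - beta2)) * ((u + u) - (u' + u')).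
Proof.
have [P Q] := quot_cvg du; have [P' Q'] := quot_cvg du'.
by apply: cvgM; [exact: cvg_cst|apply: cvgB; apply: cvgD].
Qed.

Let betaB_gt0 : 0 < beta1 - beta2.
Proof. by rewrite subr_gt0. Qed.

Let le_xh n : x + - h n <= x + h n.
Proof. by have := h_gt0 n; lra. Qed.

Let gapE n : gap n = v / (4 * n.+1%:R^-1) *
  occ (between (F (x + - h n)) (F (x + h n))) r r'.
Proof.
have := flow_occ (le_xh n) r0 rr rT; rewrite /gap /quot/=.
set o := occ _ _ _; move=> E.
have hn0 : h n != 0 by rewrite gt_eqF.
have n0 : n.+1%:R != 0 :> R by rewrite pnatr_eq0.
have -> : o = (F (x + h n) r - F (x - h n) r -
    (F (x + h n) r' - F (x - h n) r')) / (beta1 - beta2).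
  by rewrite E mulrAC divff ?mul1r// gt_eqF.
rewrite /h; field.
by rewrite -natr1 addrC in n0; rewrite n0 !gt_eqF.
Qed.

Let mb n : measurable (between (F (x + - h n)) (F (x + h n))).
Proof. by apply: open_measurable; apply: open_between; exact: flow_cont. Qed.

(** At time [r] both flow lines are eventually closer than [n.+1%:R^-1] to [F x], and by contraction
    they stay so up to [r']. Hence the region between them lies in the tube; compare occupations and
    pass to the limit. *)
Lemma step_le : lam * u < 1 ->
  lam * (u - u') <= 2 * (beta1 - beta2) / v * (l' - l).
Proof.
move=> lamu.
have [P Q] := quot_cvg du.
have ul : u < lam^-1 by rewrite -[ltRHS]mul1r ltr_pdivlMr// mulrC.
suff H : v * lam / (4 * (beta1 - beta2)) * ((u + u) - (u' + u')) <= l' - l.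
  have c0 : 0 < 2 * (beta1 - beta2) / v by rewrite divr_gt0// mulr_gt0.
  move: H; rewrite -(ler_pM2l c0); apply: le_trans.
  rewrite le_eqVlt; apply/orP; left; apply/eqP; field.
  by rewrite !gt_eqF.
apply: (ler_cvg_to gap_cvg (cvgB hl' hl)).
near=> n; rewrite [leRHS](normalized_occupationB _ _ r0 rr) gapE.
have pos : 0 < n.+1%:R^-1 :> R by [].
apply: ler_wpM2l; first by rewrite divr_ge0 ?mulr_ge0// ltW.
apply: le_occ => //; first exact: measurable_tube.
move=> s /andP[rs sr] /andP[s1 s2].
have P1 : (quot r n).1 < lam^-1 by near: n; exact: cvgr_lt ul.
have Q1 : (quot r n).2 < lam^-1 by near: n; exact: cvgr_lt ul.
have lh : lam^-1 * h n = n.+1%:R^-1 by rewrite /h mulKf// gt_eqF.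
move: P1 Q1; rewrite /quot/= ltr_pdivrMr// lh => P1.
rewrite invrN mulrN -mulNr ltr_pdivrMr// lh => Q1.
have xh1 : x <= x + h n by rewrite lerDl ltW.
have xh2 : x + - h n <= x by rewrite gerBl ltW.
have sT : s <= T by rewrite (le_trans sr).
have C1 := flow_contract xh1 r0 rs sT.
have C2 := flow_contract xh2 r0 rs sT.
rewrite /tube/= ler_norml.
move: {lh} P1 Q1 s1 s2 C1 C2; set e := n.+1%:R^-1; set fp := F (x + h n).
by set fm := F (x - h n) => P1 Q1 s1 s2 C1 C2; apply/andP; split; lra.
Unshelve. all: by end_near. Qed.

(** At time [r'] both flow lines are eventually still farther than [n.+1%:R^-1] from [F x], and by
    contraction they were so since [r]. Hence the tube lies between them. *)
Lemma step_ge : 1 < lam * u' ->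
  2 * (beta1 - beta2) / v * (l' - l) <= lam * (u - u').
Proof.
move=> lamu.
have [P Q] := quot_cvg du'.
have ul : lam^-1 < u' by rewrite -[ltLHS]mul1r ltr_pdivrMr// mulrC.
suff H : l' - l <= v * lam / (4 * (beta1 - beta2)) * ((u + u) - (u' + u')).
  have c0 : 0 < 2 * (beta1 - beta2) / v by rewrite divr_gt0// mulr_gt0.
  move: H; rewrite -(ler_pM2l c0) => /le_trans; apply.
  rewrite le_eqVlt; apply/orP; left; apply/eqP; field.
  by rewrite !gt_eqF.
apply: (ler_cvg_to (cvgB hl' hl) gap_cvg).
near=> n; rewrite [leLHS](normalized_occupationB _ _ r0 rr) gapE.
have pos : 0 < n.+1%:R^-1 :> R by [].
apply: ler_wpM2l; first by rewrite divr_ge0 ?mulr_ge0// ltW.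
apply: le_occ => //; first exact: measurable_tube.
move=> s /andP[rs sr]; rewrite /tube/= ler_norml => /andP[s1 s2].
have P1 : lam^-1 < (quot r' n).1 by near: n; exact: cvgr_gt ul.
have Q1 : lam^-1 < (quot r' n).2 by near: n; exact: cvgr_gt ul.
have lh : lam^-1 * h n = n.+1%:R^-1 by rewrite /h mulKf// gt_eqF.
move: P1 Q1; rewrite /quot/= ltr_pdivlMr// lh => P1.
rewrite invrN mulrN -mulNr ltr_pdivlMr// lh => Q1.
have xh1 : x <= x + h n by rewrite lerDl ltW.
have xh2 : x + - h n <= x by rewrite gerBl ltW.
have s0 : 0 <= s by rewrite (le_trans r0).
have C1 := flow_contract xh1 s0 sr rT.
have C2 := flow_contract xh2 s0 sr rT.
rewrite /between/=.
move: {lh} P1 Q1 s1 s2 C1 C2; set e := n.+1%:R^-1; set fp := F (x + h n).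
by set fm := F (x - h n) => P1 Q1 s1 s2 C1 C2; apply/andP; split; lra.
Unshelve. all: by end_near. Qed.

End step.

(** * The derivative of the flow at a typical initial point *)

Section derivative_at_typical_point.
Variables (x : R) (l : R -> R).
Hypothesis T0 : 0 < T.
Hypothesis lc : continuous l.
Hypothesis grid_cvg : forall n k, (k <= n)%N ->
  normalized_occupation v b (F x) (T * k%:R / n%:R) (m.+1%:R^-1)
    @[m --> \oo] --> l (T * k%:R / n%:R).
Hypothesis grid_derivable : forall n k, (k <= n)%N ->
  derivable (F ^~ (T * k%:R / n%:R)) x 1.

(** The absolute value makes [u] nonnegative at every time, as [decay_limit] asks, even where
    differentiability is unknown. At grid times it changes nothing, the flow being monotone. *)
Let u (r : R) : R := `|'D_1 (F ^~ r) x|.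

Let grid_itv n k : (k <= n)%N -> 0 <= T * k%:R / n%:R <= T.
Proof.
(* For [n = 0] the convention on division by zero gives the grid point 0. *)
case: n => [_|n kn]; first by rewrite invr0 mulr0 lexx ltW.
rewrite divr_ge0 ?mulr_ge0 ?(ltW T0)//=.
by rewrite ler_pdivrMr// ler_pM2l// ler_nat.
Qed.

Let grid_le n k : T * k%:R / n%:R <= T * k.+1%:R / n%:R.
Proof. by rewrite ler_wpM2r ?invr_ge0// ler_pM2l// ler_nat. Qed.

Let grid_derive n k : (k <= n)%N ->
  is_derive x (1 : R) (F ^~ (T * k%:R / n%:R)) (u (T * k%:R / n%:R)).
Proof.
move=> kn; set r := T * _ / _; have /andP[r0 rT] : 0 <= r <= T by exact: grid_itv.
have dr : derivable (F ^~ r) x 1 by exact: grid_derivable.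
suff dge0 : 0 <= 'D_1 (F ^~ r) x by rewrite /u ger0_norm//; exact/derivableP.
have hc : (fun n : nat => n.+1%:R^-1 : R) @ \oo --> (0 : R) by exact: cvg_harmonic.
have := @derive_cvg_seq R (F ^~ r) x _ _ ((@derivableP _ _ _ _ _ _ dr)) _ hc.
have h0 (n0 : nat) : n0.+1%:R^-1 != 0 :> R by rewrite invr_eq0 pnatr_eq0.
move=> /(_ h0) /cvgr_to_ge; apply; apply: nearW => m.
rewrite divr_ge0// subr_ge0; apply: flow_mono => //.
by rewrite lerDl.
Qed.

Lemma flow_derivative_typical :
  is_derive x (1 : R) (F ^~ T) (expR (- (2 * (beta1 - beta2) / v * l T))).
Proof.
have TE : T = T * 1%:R / 1%:R by rewrite mulr1 divr1.
have c0 : 0 < 2 * (beta1 - beta2) / v by rewrite divr_gt0// mulr_gt0// subr_gt0.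
suff <- : u T = expR (- (2 * (beta1 - beta2) / v * l T)).
  by have := @grid_derive 1 1 (leqnn 1); rewrite -TE.
(* The occupation of the degenerate interval from 0 to 0 vanishes. *)
have l0 : l 0 = 0.
  have := @grid_cvg 1%N 0%N isT; rewrite mulr0 mul0r => lc0.
  apply/esym; apply: (cvg_unique _ _ lc0) => //.
  rewrite (_ : (fun _ => _) = cst 0); first exact: cvg_cst.
  apply/funext => m; rewrite /normalized_occupation.
  by rewrite set_itv1 Rintegral_set1 mulr0.
have u0 : u 0 = 1.
  rewrite /u (_ : F ^~ 0 = id); last by apply/funext => y; rewrite flow0.
  by rewrite derive_id normr1.
apply: (@decay_limit R T (fun r => 2 * (beta1 - beta2) / v * l r) u T0) => //.
- by move=> s; apply: cvgM; [exact: cvg_cst|exact: lc].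
- by rewrite l0 mulr0.
- by move=> r; exact: normr_ge0.
move=> n k kn r r'.
have kn' : (k <= n)%N by exact: ltnW.
have rr : r <= r' by exact: grid_le.
have /andP[r0 _] : 0 <= r <= T by exact: grid_itv.
have /andP[_ rT] : 0 <= r' <= T by exact: grid_itv.
have du : is_derive x (1 : R) (F ^~ r) (u r) by exact: grid_derive.
have du' : is_derive x (1 : R) (F ^~ r') (u r') by exact: grid_derive.
have hl := grid_cvg kn'; have hl' := grid_cvg kn; rewrite -/r in hl; rewrite -/r' in hl'.
have ur : 0 <= u r by exact: normr_ge0.
have ur' : 0 <= u r' by exact: normr_ge0.
rewrite -mulrBr; split.
  apply: mulr_ge0; first exact: ltW.
  rewrite subr_ge0; apply: (ler_cvg_to hl hl'); apply: nearW => m.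
  rewrite -subr_ge0 normalized_occupationB//.
  by rewrite mulr_ge0 ?occ_ge0// divr_ge0 ?mulr_ge0// ltW.
split.
  (* If [u r] is 0 the bound is immediate. Otherwise [lam = (1 - e) / u r] is admissible in
     [step_le], and [e] tends to 0; the second bound uses [(1 + e) / u r'] in [step_ge] likewise. *)
  move: ur; rewrite le_eqVlt => /predU1P[<-|ur].
    by rewrite mulr0 sub0r oppr_le0.
  apply: (@ler_eps_mul _ _ _ (u r)) => [|e e0 e1]; first exact: ltW.
  have lam0 : 0 < (1 - e) / u r by rewrite divr_gt0// subr_gt0.
  have := step_le r0 rr rT du du' hl hl' lam0.
  rewrite divfK ?gt_eqF// => /(_ _); rewrite mulrAC ler_pdivrMr// => H.
  have : (1 - e) * (u r - u r') <= 2 * (beta1 - beta2) / v * (l r' - l r) * u r.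
    by apply: H; rewrite gtrBl.
  have : 0 <= e * u r' by rewrite mulr_ge0// ltW.
  by move: (_ * u r) => W; lra.
move: ur'; rewrite le_eqVlt => /predU1P[<-|ur'].
  by rewrite mulr0 subr0.
apply: (@ler_eps_mul _ _ _ (u r)) => // e e0 e1.
have lam0 : 0 < (1 + e) / u r' by rewrite divr_gt0// addr_gt0.
have := step_ge r0 rr rT du du' hl hl' lam0.
rewrite divfK ?gt_eqF// => /(_ _); rewrite [leRHS]mulrAC ler_pdivlMr// => H.
have : 2 * (beta1 - beta2) / v * (l r' - l r) * u r' <= (1 + e) * (u r - u r').
  by apply: H; rewrite ltrDl.
have : 0 <= e * u r' by rewrite mulr_ge0// ltW.
by move: (_ * u r') => W; lra.
Qed.

End derivative_at_typical_point.

(** At almost every [x] the occupation limits hold and all maps [F ^~ r], for the countably many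
    grid times [r], are differentiable. There the exponential is the derivative of the Lipschitz map
    [F ^~ T], which is therefore its integral. *)
Lemma flow_space_integral (L : R -> R -> R) : 0 < T ->
  (forall x, continuous (L x)) -> continuous (L ^~ T) ->
  {ae mu, forall x, forall n k, (k <= n)%N ->
    normalized_occupation v b (F x) (T * k%:R / n%:R) (m.+1%:R^-1)
      @[m --> \oo] --> L x (T * k%:R / n%:R)} ->
  forall x1 x2, x1 <= x2 -> F x2 T - F x1 T =
    \int[mu]_(x in `[x1, x2]) expR (- (2 * (beta1 - beta2) / v * L x T)).
Proof.
move=> T0 Lt Lx hL x1 x2 x12.
have gc : continuous (fun x => expR (- (2 * (beta1 - beta2) / v * L x T))).
  move=> x; apply: continuous_comp; last exact: continuous_expR.
  by apply: cvgN; apply: cvgM; [exact: cvg_cst|exact: Lx].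
have mg : measurable_fun setT (fun x => expR (- (2 * (beta1 - beta2) / v * L x T))).
  exact: continuous_measurable_fun.
apply: (lip_ae_integral ltr01 (flow_lip_init (ltW T0) (lexx T)) x12).
  exact: measurable_funTS.
have hd : {ae mu, forall x, forall n k, (k <= n)%N ->
    derivable (F ^~ (T * k%:R / n%:R)) x 1}.
  apply: ae_foralln => n; apply: ae_foralln => k.
  have [kn|nk] := leqP k n; last by apply: aeW.
  have := @flow_lip_init (T * k%:R / n%:R) => /(_ _ _)/(lip_ae_derivable ltr01) H.
  apply: ae_lebesgueS (H _ _) => [x //||].
    by rewrite divr_ge0 ?mulr_ge0// ltW.
  case: n kn {H} => [_|n kn]; first by rewrite invr0 mulr0 ltW.
  by rewrite ler_pdivrMr// ler_pM2l// ler_nat.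
apply: ae_lebesgueS (ae_lebesgueI hL hd) => x [h1 h2] _.
exact: (flow_derivative_typical T0 (Lt x) h1 h2).
Qed.

Lemma flow_above x r r' : r <= r' -> (forall s, r < s < r' -> b s < F x s) ->
  F x r' - F x r = beta2 * (r' - r).
Proof.
move=> rr Fb; have [K K0 KF] := flow_lip x.
have [_ _ _ h2] := hF x.
apply/eqP; rewrite eq_le; apply/andP; split.
  apply: lip_ae_le K0 KF rr _.
  by apply: aeW => s srr; exists beta2 => //; apply: h2; exact: Fb.
apply: lip_ae_ge K0 KF rr _.
by apply: aeW => s srr; exists beta2 => //; apply: h2; exact: Fb.
Qed.

(* Once the error exceeds the oscillation of [b] over one step, the scheme and
   the solution lie on the same side of [b] during the step, or their slopes
   bring them closer. *)
Lemma euler_error x h e n : 0 < h -> n%:R * h <= T ->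
  (forall s s', 0 <= s <= T -> `|s' - s| <= h -> `|b s' - b s| <= e) ->
  `|euler beta1 beta2 b h x n - F x (n%:R * h)| <= e + 2 * beta1 * h.
Proof.
move=> h0 + osc; have beta1_gt0 := lt_trans beta2_gt0 beta_lt.
have bh1 : 0 < beta1 * h by rewrite mulr_gt0.
have bh2 : 0 < beta2 * h by rewrite mulr_gt0.
have bh : beta2 * h < beta1 * h by rewrite ltr_pM2r.
elim: n => [T0|n IH nT].
  have e0 : 0 <= e.
    rewrite -(_ : `|b 0 - b 0| = 0); last by rewrite subrr normr0.
    apply: osc; last by rewrite subrr normr0 ltW.
    by move: T0; rewrite mul0r lexx.
  by rewrite mul0r flow0 subrr normr0 addr_ge0// !mulr_ge0// ltW.
set s := n%:R * h in IH *.
have -> : n.+1%:R * h = s + h by rewrite -natr1 mulrDl mul1r.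
have s0 : 0 <= s by rewrite mulr_ge0// ltW.
have ssh : s <= s + h by rewrite lerDl ltW.
have shT : s + h <= T by rewrite -(mul1r h) -mulrDl natr1.
have sT := le_trans ssh shT.
move: (IH sT); rewrite !ler_norml => /andP[IH1 IH2].
have hh : s + h - s = h by rewrite addrAC subrr add0r.
have f1 := flow_le x s0 ssh shT; rewrite hh in f1.
have f2 := flow_ge x s0 ssh shT; rewrite hh in f2.
have osc' q : s < q -> q < s + h -> b s - e <= b q <= b s + e.
  move=> sq qh; have : `|b q - b s| <= e.
    apply: osc; first by rewrite s0.
    by rewrite ger0_norm ?subr_ge0 ?(ltW sq)//; rewrite lerBlDl ltW.
  by rewrite ler_norml => /andP[? ?]; apply/andP; split; lra.
rewrite /=; set E := euler _ _ _ _ _ n in IH1 IH2 *; rewrite -/s.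
case: ltP => Eb.
  have [allb|] := pselect (forall q, s < q < s + h -> F x q < b q).
    have := flow_below ssh allb; rewrite hh => fE.
    by apply/andP; split; lra.
  (* The solution reaches [b] at [q], so [F x s] is above [E - e - beta1 * h]; one more step of the
     scheme gives the constant [e + 2 * beta1 * h]. In the other direction the error cannot grow,
     since [beta1] is the largest slope. *)
  move=> /existsNP[q /not_implyP[/andP[sq qh] /negP]]; rewrite -leNgt => bF.
  have /andP[w1 w2] := osc' q sq qh.
  have qT : q <= T by rewrite (le_trans _ shT)// ltW.
  have := flow_le x s0 (ltW sq) qT.
  have : beta1 * (q - s) <= beta1 * h by rewrite ler_pM2l// lerBlDl ltW.
  by move=> g1 g2; apply/andP; split; lra.
have [allb|] := pselect (forall q, s < q < s + h -> b q < F x q).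
  have := flow_above ssh allb; rewrite hh => fE.
  by apply/andP; split; lra.
(* Symmetrically, [F x s] is at most [E + e], and the scheme now moves with the smallest slope
   [beta2]. *)
move=> /existsNP[q /not_implyP[/andP[sq qh] /negP]]; rewrite -leNgt => bF.
have /andP[w1 w2] := osc' q sq qh.
have qT : q <= T by rewrite (le_trans _ shT)// ltW.
have := flow_ge x s0 (ltW sq) qT.
have : 0 <= beta2 * (q - s) by rewrite mulr_ge0 ?ltW// subr_gt0.
by move=> g1 g2; apply/andP; split; lra.
Qed.

Lemma euler_cvg x s : 0 <= s -> s <= T ->
  euler beta1 beta2 b (s / n.+1%:R) x n.+1 @[n --> \oo] --> F x s.
Proof.
rewrite le_eqVlt => /predU1P[<- _|s0 sT].
  rewrite (_ : (fun _ => _) = cst (F x 0)); first exact: cvg_cst.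
  apply/funext => n; rewrite mul0r flow0.
  by elim: n.+1 => //= m ->; rewrite !mulr0 addr0.
apply/(@cvgrPdist_le _ R^o) => e e0.
have e20 : 0 < e / 2 by rewrite divr_gt0.
have [delta delta0 osc] := itv_unif_continuous 0 T bc e20.
have beta1_gt0 := lt_trans beta2_gt0 beta_lt.
have hcv : s / n.+1%:R @[n --> \oo] --> (0 : R).
  by rewrite -(mulr0 s); apply: cvgM; [exact: cvg_cst|exact: cvg_harmonic].
near=> n.
have hn0 : 0 < s / n.+1%:R by rewrite divr_gt0.
have hE : n.+1%:R * (s / n.+1%:R) = s by rewrite mulrC divfK// pnatr_eq0.
have hd : s / n.+1%:R <= delta.
  by near: n; exact: cvgr_le hcv _ delta0.
have he : s / n.+1%:R <= e / (4 * beta1).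
  by near: n; apply: cvgr_le hcv _ _; rewrite divr_gt0// mulr_gt0.
have := @euler_error x (s / n.+1%:R) (e / 2) n.+1 hn0.
rewrite hE => /(_ sT) H; rewrite distrC.
apply: (le_trans (H _)).
  by move=> r r' rT rr; apply: osc => //; exact: le_trans hd.
rewrite [leRHS]splitr lerD2l.
apply: (@le_trans _ _ (2 * beta1 * (e / (4 * beta1)))).
  by rewrite ler_pM2l// mulr_gt0.
rewrite le_eqVlt; apply/orP; left; apply/eqP; field.
by rewrite gt_eqF.
Unshelve. all: by end_near. Qed.

End flow.

(** * Times at which a Lipschitz function meets the path *)

Section coincidence.
Context {R : realType}.
Local Notation mu := (@lebesgue_measure R).

Lemma lebesgue_measure_shift (A : set R) (h : R) : measurable A ->
  mu [set s | A (s + h)] = mu A.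
Proof.
move=> mA.
have mf : measurable_fun [set: measurableTypeR R]
    ((fun s => s + h) : _ -> measurableTypeR R).
  by apply: measurable_funD.
pose nu : {measure set (measurableTypeR R) -> \bar R} :=
  measure_function_pushforward__canonical__measure_function_Measure mu mf.
rewrite -[LHS]/(nu A); apply/esym.
apply: (@lebesgue_measure_unique R nu) => // X /ocitvP[->|[[a c] /= ac ->]].
  by rewrite !measure0.
rewrite /nu/= /pushforward.
rewrite (_ : _ @^-1` _ = `]a - h, c - h]%classic).
  rewrite !lebesgue_measure_itv/= !lte_fin ltrD2r ac -!EFinB; congr EFin; ring.
by apply/seteqP; split => s; rewrite /= !in_itv/= ltrBlDr lerBrDr.
Qed.

(* If [f] and [b] agree at both [s] and [s + h], then [b] varies by at most
   [K * h] between them; and almost every point of a closed set [E] remains in [E]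
   after a small shift, up to a set of small measure. *)
Lemma coincidence_null (b : R -> R) (T : R) (K : R) (f : R -> R) (h : R^nat) :
  continuous b -> lip K f -> (forall n, 0 < h n) -> h @ \oo --> (0 : R) ->
  limn_einf (fun n =>
    mu ([set s | `|b (s + h n) - b s| <= K * h n] `&` `[0, T])) = 0%E ->
  {ae mu, forall s, 0 < s < T -> f s != b s}.
Proof.
move=> bc fL h0 hc H.
pose E := [set s | 0 <= s <= T /\ f s = b s].
have clE : closed E.
  rewrite (_ : E = `[0, T]%classic `&` (f \- b) @^-1` [set 0]).
    apply: closedI; first exact: interval_closed.
    apply: closed_comp; last exact: closed_eq.
    by move=> s _; apply: cvgB; [exact: (lip_continuous fL)|exact: bc].
  apply/seteqP; split => s /=; rewrite in_itv/= => -[s0 fb]; split => //.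
    by rewrite fb subrr.
  exact: subr0_eq.
have mE : measurable E by exact: closed_measurable.
pose Eh n := [set s | E (s + h n)].
have mEh n : measurable (Eh n).
  apply: closed_measurable; apply: (@closed_comp _ _ (fun s => s + h n)) => //.
  by move=> s _; apply: cvgD; [exact: cvg_id|exact: cvg_cst].
have mDE n : measurable (Eh n `\` E) by exact: measurableD.
suff E0 : mu E = 0.
  exists E; split => // s /= /not_implyP[/andP[s0 sT] /negP].
  by rewrite negbK => /eqP fb; split => //; rewrite !ltW.
(* For [h n <= 1] the shifted set lies in the bounded window from [M'] to [M], so the constant 1 is
   an integrable bound. *)
pose M : R := T + 1.
pose M' : R := - 1.
pose c n : \bar R := mu (Eh n `\` E).
(* A point off the closed set [E] stays off [E] under all small shifts; dominated convergence
   concludes. *)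
have c0 : c @ \oo --> 0%E.
  have hM : \forall n \near \oo, h n <= 1 by apply: cvgr_le hc _ _; exact: ltr01.
  pose c' n : \bar R := (\int[mu]_(s in `[M', M]) (\1_(Eh n `\` E) s)%:E)%E.
  have : c' @ \oo --> (\int[mu]_(s in `[M', M]) 0%:E)%E.
    have mI : measurable (`[M', M]%classic : set (measurableTypeR R)) by [].
    have [|||||_ _ //] := @dominated_convergence _ _ _ mu _ mI
      (fun n s => (\1_(Eh n `\` E) s)%:E) (fun=> 0%E) (fun=> 1%E).
    - move=> n; apply/measurable_EFinP/measurable_funTS.
      by apply: measurable_indic; exact: mDE.
    - exact: measurable_cst.
    - apply: aeW => s _.
      have [Es|nEs] := pselect (E s).
        rewrite (_ : (fun _ => _) = cst 0%E); first exact: cvg_cst.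
        by apply/funext => n; rewrite indicE memNset// => -[].
      have oC : open (~` E) by exact: closed_openC.
      have cs : (fun n => s + h n) @ \oo --> s.
        by rewrite -[X in _ --> X]addr0; apply: cvgD => //; exact: cvg_cst.
      apply: cvg_near_cst; near=> n.
      rewrite indicE memNset// => -[+ _]; rewrite /Eh.
      by near: n; exact: (cs _ (open_nbhs_nbhs (conj oC nEs))).
    - exact: (integrable_cst_itv M' M 1).
    - apply: aeW => s n _; rewrite /= lee_fin indicE.
      by case: (_ \in _); rewrite ?normr1 ?normr0.
  rewrite integral0; apply: cvg_trans; apply: near_eq_cvg; near=> n.
  rewrite /c' /c integral_indic//; last exact: mDE.
  congr (mu _); rewrite setIidl// => s -[[/andP[sh0 shT] _] _].
  have hn1 : h n <= 1 by near: n.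
  by have := h0 n; rewrite /= in_itv/= /M /M' => hn0; apply/andP; split; lra.
pose S n := [set s | `|b (s + h n) - b s| <= K * h n] `&` `[0, T].
(* By translation invariance [E] may be replaced by its shift [Eh n]; a point of [Eh n] that is also
   in [E] is in [S n]. *)
have le1 n : (mu E <= c n + mu (S n))%E.
  have mS : measurable (S n).
    apply: measurableI => //; apply: closed_measurable.
    rewrite (_ : [set s | _] =
      (fun s => `|b (s + h n) - b s|) @^-1` [set y | y <= K * h n])//.
    apply: closed_comp; last exact: closed_le.
    move=> s _; apply: cvg_norm; apply: cvgB; last exact: bc.
    apply: (@continuous_comp _ _ _ (fun s => s + h n)); last exact: bc.
    by apply: cvgD; [exact: cvg_id|exact: cvg_cst].
  rewrite -(lebesgue_measure_shift (h n) mE).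
  apply: (@le_trans _ _ (mu ((Eh n `\` E) `|` S n))).
    apply: le_measure; rewrite ?inE.
    - exact: mEh.
    - by apply: measurableU; [exact: mDE|exact: mS].
    - move=> s Ehs; have [Es|nEs] := pselect (E s); last by left; split.
      right; have [s0 fb] := Es; have [_ fbh] := Ehs.
      split; last by rewrite /= in_itv.
      rewrite /= -fb -fbh (le_trans (fL _ _))//.
      by rewrite addrAC subrr add0r ger0_norm// ltW.
  by apply: measureU2; [exact: mDE|exact: mS].
have Efin : (mu E < +oo)%E.
  apply: (@le_lt_trans _ _ (mu `[0, T])); last first.
    by rewrite lebesgue_measure_itv/=; case: ifP => _; rewrite -?EFinB ltry.
  by apply: le_measure; rewrite ?inE// => s [s0 _]; rewrite /= in_itv.
(* If [E] had measure [m > 0], then eventually [c n <= m / 2], so [S n] would keep measure at least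
   [m / 2], against the vanishing lower limit. *)
apply: contrapT => /eqP; rewrite -measure_gt0 => E0.
have [m mE'] : exists m : R, mu E = m%:E.
  by exists (fine (mu E)); rewrite fineK// ge0_fin_numE.
have m20 : 0 < m / 2 by rewrite divr_gt0// -lte_fin -mE'.
suff : ((m / 2)%:E <= 0 :> \bar R)%E by rewrite lee_fin leNgt m20.
rewrite -H limn_einf_lim; apply: lime_ge; first exact: is_cvg_einfs.
have cm : \forall n \near \oo, (c n <= (m / 2)%:E)%E.
  have := c0; rewrite -[0%E]/(0%:E) => /fine_cvgP[cfin /cvgr_le/(_ _ m20)].
  by apply: filterS2 cfin => n cn; rewrite -lee_fin fineK.
case: cm => N _ cm; exists N => // k /= Nk.
apply: le_ereal_inf_tmp => _ [n /= kn <-].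
have := le1 n; rewrite mE' => /le_trans/(_ (leeD2r _ (cm n (leq_trans Nk kn)))).
by rewrite [X in (X%:E <= _)%E]splitr EFinD leeD2lE.
Unshelve. all: by end_near. Qed.

End coincidence.

(** * Joint measurability *)

Section joint_measurability.
Context d (T : measurableType d) (R : realType).
Local Notation mu := (@lebesgue_measure R).
Local Notation mR := (measurableTypeR R).

Lemma grid_approx (s : R) :
  (Num.floor (s * n.+1%:R))%:~R / n.+1%:R @[n --> \oo] --> s.
Proof.
apply/(@cvgrPdist_le _ R^o) => e e0; near=> n.
have n0 : 0 < n.+1%:R :> R by [].
apply: (@le_trans _ _ (n.+1%:R^-1)); last first.
  by near: n; apply: cvgr_le (cvg_harmonic) _ _.
set z := Num.floor _.
have /andP[z1 z2] : z%:~R <= s * n.+1%:R < (z + 1)%:~R.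
  by apply: real_floor_itv; exact: num_real.
rewrite -[s in X in X <= _](mulfK (lt0r_neq0 n0)) -mulrBl normrM.
rewrite [X in _ * X]gtr0_norm ?invr_gt0// -[leRHS]mul1r ler_pM2r ?invr_gt0//.
rewrite ger0_norm ?subr_ge0//.
by move: z2; rewrite intrD1 => z2; lra.
Unshelve. all: by end_near. Qed.

(** The Caratheodory argument: rounding the first variable down to a grid gives functions that are
    measurable on countably many strips, and they converge to [g] by continuity. Sections need to be
    measurable at rational points only. *)
Lemma joint_measurable (g : R -> T -> R) :
  (forall (z : int) n, measurable_fun setT (g (z%:~R / n.+1%:R))) ->
  (forall w, continuous (g ^~ w)) ->
  measurable_fun [set: mR * T] (fun p : mR * T => g p.1 p.2).
Proof.
move=> mg cg.
pose gn (n : nat) (p : mR * T) :=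
  g ((Num.floor ((p.1 : R) * n.+1%:R))%:~R / n.+1%:R) p.2.
apply: (@measurable_fun_cvg _ _ _ setT gn).
  move=> n _ Y mY; rewrite setTI.
  have -> : gn n @^-1` Y = \bigcup_(z : int)
      ((fst @^-1` [set s : mR | z%:~R / n.+1%:R <= (s : R) < (z + 1)%:~R / n.+1%:R]) `&`
       (snd @^-1` (g (z%:~R / n.+1%:R) @^-1` Y))).
    apply/seteqP; split => [[s w] /= Ys|[s w] [z _ [/= zs Ys]]].
      exists (Num.floor (s * n.+1%:R)) => //; split => //=.
      by rewrite ler_pdivrMr// ltr_pdivlMr// real_floor_itv// num_real.
    rewrite /gn/= (_ : Num.floor (s * n.+1%:R) = z)//.
    by apply: floor_def; rewrite -ler_pdivrMr// -ltr_pdivlMr.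
  apply: countable_bigcupT_measurable; first exact: countableP.
  move=> z; apply: measurableI.
    rewrite -[X in measurable X]setTI; apply: measurable_fst => //.
    rewrite (_ : [set _ | _] = `[z%:~R / n.+1%:R, (z + 1)%:~R / n.+1%:R[%classic)//.
  rewrite -[X in measurable X]setTI; apply: measurable_snd => //.
  by rewrite -[X in measurable X]setTI; exact: mg.
move=> [s w] _ /=.
apply: (@cvg_comp _ _ _ _ (fun u => g u w)); last exact: cg.
exact: grid_approx.
Qed.

Variable P : probability T R.

Lemma tonelli_sections (A : set (mR * T)) : measurable A ->
  (\int[mu]_s P (xsection A s) = \int[P]_w mu (ysection A w))%E.
Proof.
move=> mA; have := @indic_fubini_tonelli _ _ mR T R mu P A mA.
rewrite (_ : (fun x => _) = P \o xsection A); last first.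
  exact: indic_fubini_tonelli_FE.
rewrite [X in _ = (\int[_]_x X x)%E -> _](_ : _ = mu \o ysection A)//.
exact: indic_fubini_tonelli_GE.
Qed.

(** All sections of the complement at fixed [s] are null, so by Tonelli almost every section at
    fixed [w] is null. This is where joint measurability enters. *)
Lemma ae_swap (A : set (mR * T)) : measurable A ->
  (forall s, {ae P, forall w, A (s, w)}) ->
  {ae P, forall w, {ae mu, forall s, A (s, w)}}.
Proof.
move=> mA h; have mC : measurable (~` A) by exact: measurableC.
have := tonelli_sections mC; rewrite integral0_eq; last first.
  move=> s _; apply/negligibleP; first exact: measurable_xsection.
  apply: negligibleS (h s) => w; rewrite /xsection/= inE.
  exact.
move=> /esym H.
have mG : measurable_fun setT (mu \o ysection (~` A)).
  exact: measurable_fun_ysection.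
have : ae_eq P setT (mu \o ysection (~` A)) (cst 0%E).
  apply/(ae_eq_integral_abs P measurableT mG).
  by under eq_integral do rewrite gee0_abs//.
apply: filterS => w /(_ I) /= H0.
have /negligibleP/iffRL/(_ H0) := @measurable_ysection _ _ _ _ _ w mC.
by apply: negligibleS => s /= nA; rewrite /ysection/= inE.
Qed.

End joint_measurability.

(** * Small increments of Brownian motion *)

Section brownian_coincidence.
Context d (Omega : measurableType d) (R : realType).
Variables (P : probability Omega R) (v : R) (B : R -> {RV P >-> R}).
Hypothesis v0 : 0 < v.
Hypothesis hB : two_sided_brownian_motion v B.
Local Notation mu := (@lebesgue_measure R).
Local Notation mR := (measurableTypeR R).

Lemma normal_peakM (s q : R) : 0 < s -> 0 < q ->
  normal_peak (s * q) = normal_peak s / q.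
Proof.
move=> s0 q0; rewrite /normal_peak exprMn -mulrnAr mulrAC mulrnAr.
have p0 : 0 <= s ^+ 2 * pi *+ 2 by rewrite mulrn_wge0// mulr_ge0 ?sqr_ge0 ?pi_ge0.
by rewrite sqrtrM// sqrtr_sqr gtr0_norm// invfM.
Qed.

(** Over a time [q ^+ 2] the Gaussian density is at most a constant over [q], while the interval has
    length [2 * K * q ^+ 2]. Writing the time as a square avoids square roots of it. *)
Lemma brownian_small_ball (K s q : R) : 0 <= K -> 0 < q ->
  (P [set w | (`|B (s + q ^+ 2) w - B s w| <= K * q ^+ 2)%R] <=
  (2 * K * normal_peak (Num.sqrt v) * q)%:E)%E.
Proof.
move=> K0 q0; have [_ _ _ incr] := hB.
have q20 : 0 < q ^+ 2 by rewrite exprn_gt0.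
have sq : s < s + q ^+ 2 by rewrite ltrDl.
pose c := K * q ^+ 2.
have c0 : 0 <= c by rewrite mulr_ge0// ltW.
have mI : measurable (`[- c, c]%classic : set R) by [].
have := incr _ _ sq _ mI.
rewrite addrAC subrr add0r sqrtrM ?(ltW v0)// sqrtr_sqr gtr0_norm//.
rewrite (_ : [set w | _] = [set w | `|B (s + q ^+ 2) w - B s w| <= c]); last first.
  by apply/seteqP; split => w; rewrite /= in_itv/= ler_norml.
move=> ->.
have sv0 : 0 < Num.sqrt v by rewrite sqrtr_gt0.
rewrite /normal_prob.
apply: (@le_trans _ _
    (\int[mu]_(x in `[(- c)%R, c]) (normal_peak (Num.sqrt v * q))%:E)%E).
  apply: ge0_le_integral => //.
  - by move=> x _; rewrite lee_fin normal_pdf_ge0.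
  - by apply/measurable_EFinP/measurable_funTS; exact: measurable_normal_pdf.
  - by move=> x _; rewrite lee_fin normal_pdf_ub// gt_eqF// mulr_gt0.
rewrite integral_cst//= lebesgue_measure_itv/= lte_fin normal_peakM//.
case: ifP => _; last first.
  by rewrite mule0 lee_fin !mulr_ge0// ?normal_peak_ge0// ltW.
rewrite -EFinB -EFinM lee_fin /c le_eqVlt; apply/orP; left; apply/eqP; field.
by rewrite gt_eqF.
Qed.

(** By Tonelli and the small-ball bound, the expected measure of these times is of order
    [n.+1%:R^-1]. Fatou's lemma makes the expectation of the lower limit 0, and the lower limit is
    nonnegative. *)
Lemma brownian_increments (K T : R) : 0 <= K -> 0 < T ->
  {ae P, forall w, limn_einf (fun n => mu ([set s |
    `|B (s + (n.+1%:R^-1) ^+ 2) w - B s w| <= K * (n.+1%:R^-1) ^+ 2] `&`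
    `[0, T])) = 0%E}.
Proof.
move=> K0 T0; have [_ [N [mN N0 NP]] _ _] := hB.
have cB w : ~ N w -> continuous (B ^~ w).
  by move=> nN; apply: contrapT => nc; apply: nN; exact: NP.
(* Joint measurability asks for continuity of every path, so the discontinuous ones are replaced by
   0. *)
pose B' (s : R) (w : Omega) : R := if w \in N then 0 else B s w.
have mB' s : measurable_fun setT (B' s).
  apply: measurable_fun_ifT => //.
  by apply: (measurable_fun_bool true); rewrite setTI preimage_mem_true.
have cB' w : continuous (B' ^~ w).
  rewrite /B'; case: (boolP (w \in N)) => [_ s|/negP nN]; first exact: cvg_cst.
  by apply: cB => Nw; apply: nN; rewrite inE.
pose h (n : nat) : R := (n.+1%:R^-1) ^+ 2.
pose incr n (p : mR * Omega) : R := `|B' ((p.1 : R) + h n) p.2 - B' p.1 p.2|.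
have mincr n : measurable_fun setT (incr n).
  apply: measurableT_comp => //; apply: measurable_funB.
    apply: (joint_measurable (g := fun s w => B' (s + h n) w)) => [z m|w s].
      exact: mB'.
    apply: (@continuous_comp _ _ _ (fun s => s + h n) (B' ^~ w)); last exact: cB'.
    by apply: cvgD; [exact: cvg_id|exact: cvg_cst].
  by apply: (joint_measurable (g := B')) => [z m|w]; [exact: mB'|exact: cB'].
pose S n : set (mR * Omega) :=
  [set p | incr n p <= K * h n] `&` fst @^-1` (`[0, T]%classic : set mR).
have mS n : measurable (S n).
  apply: measurableI.
    rewrite -[X in measurable X]setTI.
    apply: (mincr n measurableT [set y | y <= K * h n]).
    by apply: closed_measurable; exact: closed_le.
  by rewrite -[X in measurable X]setTI; apply: measurable_fst.
pose a n w := mu (ysection (S n) w).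
have ma n : measurable_fun setT (a n) by exact: measurable_fun_ysection.
pose c (n : nat) : R := 2 * K * normal_peak (Num.sqrt v) * n.+1%:R^-1.
have c0 n : 0 <= c n by rewrite !mulr_ge0// normal_peak_ge0.
have Pa n : (\int[P]_w a n w <= (c n * T)%:E)%E.
  rewrite -tonelli_sections//.
  apply: (@le_trans _ _ (\int[mu]_(s in `[0%R, T]) (c n)%:E)%E); last first.
    rewrite integral_cst//= lebesgue_measure_itv/= lte_fin T0.
    by rewrite -EFinB -EFinM subr0.
  rewrite [leRHS]integral_mkcond/=; apply: ge0_le_integral => //.
  - exact: measurable_fun_xsection.
  - by apply/(measurable_restrictT _ _).1.
  move=> s _; rewrite patchE; case: ifPn => [sT|/negP sT]; last first.
    rewrite (_ : xsection _ _ = set0) ?measure0//.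
    apply/seteqP; split => w //; rewrite /xsection/= inE => -[_ /=] sT'.
    by apply: sT; rewrite inE.
  have mD : measurable [set w | `|B (s + h n) w - B s w| <= K * h n].
    rewrite -[X in measurable X]setTI.
    have mf : measurable_fun setT (fun w => `|B (s + h n) w - B s w|).
      by apply: measurableT_comp => //; exact: measurable_funB.
    apply: (mf measurableT [set y | y <= K * h n]).
    by apply: closed_measurable; exact: closed_le.
  (* On [N] the increments of [B'] vanish, so [N] has to be added; it costs nothing. *)
  apply: (@le_trans _ _ (P ([set w | `|B (s + h n) w - B s w| <= K * h n] `|` N))).
    apply: le_measure; rewrite ?inE//.
    - exact: measurable_xsection.
    - exact: measurableU.
    move=> w; rewrite /xsection/= inE => -[/= + _]; rewrite /incr/= /B'.
    case: (boolP (w \in N)) => [+ _|_ H]; last by left.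
    by rewrite inE; right.
  rewrite -[leRHS]adde0 -N0; apply: (le_trans (measureU2 _ _ _)) => //.
  by rewrite leeD2r//; exact: brownian_small_ball.
have a0 : (fun n => \int[P]_w a n w)%E @ \oo --> 0%E.
  apply: (@squeeze_cvge _ _ _ _ (cst 0%E) _ (fun n => (c n * T)%:E)).
  - by apply: nearW => n; rewrite Pa andbT; apply: integral_ge0.
  - exact: cvg_cst.
  - apply: cvg_EFin; first exact: nearW.
    rewrite -(mul0r T); apply: cvgM; last exact: cvg_cst.
    rewrite -(mulr0 (2 * K * normal_peak (Num.sqrt v))).
    by apply: cvgM; [exact: cvg_cst|exact: cvg_harmonic].
have me : measurable_fun setT (fun w => limn_einf (a ^~ w)).
  have mNa n : measurable_fun setT (fun w => - a n w)%E.
    by apply: measurableT_comp (ma n); exact: oppe_measurable.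
  have := measurable_fun_limn_esup mNa; apply: measurableT_comp.
  exact: oppe_measurable.
have e0 w : (0 <= limn_einf (a ^~ w))%E.
  rewrite limn_einf_lim; apply: lime_ge; first exact: is_cvg_einfs.
  by apply: nearW => n; apply: le_ereal_inf_tmp => _ [m _ <-].
have I0 : (\int[P]_w limn_einf (a ^~ w) = 0)%E.
  apply/eqP; rewrite eq_le integral_ge0 ?andbT//.
  have := fatou P measurableT ma => /(_ (fun n w _ => measure_ge0 _ _)).
  by rewrite (cvg_limn_einf_sup a0).1.
have : ae_eq P setT (fun w => limn_einf (a ^~ w)) (cst 0%E).
  apply/(ae_eq_integral_abs P measurableT me).
  by under eq_integral do rewrite gee0_abs//.
have aN : {ae P, forall w, ~ N w}.
  by exists N; split => // w /= /contrapT.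
move=> aE; apply: filterS2 aN aE => w nN /(_ I) /= <-.
congr limn_einf; apply/funext => n; rewrite /a; congr (mu _).
apply/seteqP; split => s; rewrite /ysection/= inE /S /incr/= /B' memNset//.
Qed.

(** The exceptional null set must not depend on [f], since the solutions vary with the path. The
    increment condition mentions only a Lipschitz constant, and integer constants suffice. *)
Lemma brownian_coincidence_null (T : R) : 0 < T ->
  {ae P, forall w, forall K f, lip K f ->
    {ae mu, forall s : R, 0 < s < T -> f s != B s w}}.
Proof.
move=> T0; have [_ cB _ _] := hB.
have incr : {ae P, forall w, forall k : nat, limn_einf (fun n => mu ([set s |
    `|B (s + (n.+1%:R^-1) ^+ 2) w - B s w| <= k%:R * (n.+1%:R^-1) ^+ 2] `&`
    `[0, T])) = 0%E}.
  by apply: ae_foralln => k; exact: brownian_increments.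
apply: filterS2 cB incr => w cw incrw K f fL.
have fL' : lip (Num.bound `|K|)%:R f.
  move=> x y; apply: (le_trans (fL x y)); rewrite ler_wpM2r//.
  by rewrite (le_trans (ler_norm K))// ltW// archi_boundP.
apply: (coincidence_null cw fL' _ _ (incrw _)) => [n|].
  by rewrite exprn_gt0.
rewrite -(mulr0 (0 : R)) -[X in X @ _](_ : (fun n => n.+1%:R^-1 * n.+1%:R^-1) = _) //.
by apply: cvgM; exact: cvg_harmonic.
Qed.

End brownian_coincidence.

(** * Almost every initial point is typical *)

Section measurable_events.
Context d (T : measurableType d) (R : realType).

Lemma ae_forall_countable (P : {measure set T -> \bar R}) (I : countType)
    (Q : I -> T -> Prop) :
  (forall i, {ae P, forall w, Q i w}) -> {ae P, forall w, forall i, Q i w}.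
Proof.
move=> aQ; pose Q' n w := if unpickle n is Some i then Q i w else True.
have : {ae P, forall w, forall n, Q' n w}.
  apply: ae_foralln => n; rewrite /Q'; case: (unpickle n) => [i|]; first exact: aQ.
  exact: aeW.
by apply: filterS => w h i; have := h (pickle i); rewrite /Q' pickleK.
Qed.

Lemma measurable_cvg_set (h : nat -> T -> R) (f : T -> R) :
  (forall n, measurable_fun setT (h n)) -> measurable_fun setT f ->
  measurable [set w | h n w @[n --> \oo] --> f w].
Proof.
move=> mh mf.
rewrite (_ : [set w | _] = \bigcap_j \bigcup_M \bigcap_n
    [set w | (M <= n)%N ==> (`|f w - h n w| <= j.+1%:R^-1)]).
  apply: bigcapT_measurable => j; apply: bigcupT_measurable => M.
  apply: bigcapT_measurable => n; case: (leqP M n) => _ /=; last first.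
    by rewrite (_ : [set w | _] = setT)//; apply/seteqP; split.
  rewrite -[X in measurable X]setTI.
  have mfh : measurable_fun setT (fun w => `|f w - h n w|).
    by apply: measurableT_comp => //; exact: measurable_funB.
  apply: (mfh measurableT [set y | y <= j.+1%:R^-1]).
  by apply: closed_measurable; exact: closed_le.
apply/seteqP; split => w /=.
  move=> /(@cvgrPdist_le _ R^o) hw j _.
  have [M _ HM] := hw j.+1%:R^-1 ltac:(by rewrite invr_gt0).
  by exists M => // n _ /=; apply/implyP => Mn; exact: HM.
move=> H; apply/(@cvgrPdist_le _ R^o) => e e0.
have [M _ HM] := H (Num.bound e^-1) I; exists M => // n /= Mn.
have /implyP/(_ Mn) := HM n I => /le_trans; apply.
rewrite -[leRHS]invrK lef_pV2 ?posrE ?invr_gt0//.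
rewrite (@le_trans _ _ (Num.bound e^-1)%:R) ?ler_nat//.
by rewrite ltW// archi_boundP// invr_ge0 ltW.
Qed.

Lemma measurable_euler (beta1 beta2 h x : R) (B : R -> T -> R) n :
  (forall s, measurable_fun setT (B s)) ->
  measurable_fun setT (fun w => euler beta1 beta2 (B ^~ w) h x n).
Proof.
move=> mB; elim: n => [|n IH] /=; first exact: measurable_cst.
apply: measurable_funD => //; apply: measurable_funM => //.
by apply: measurable_fun_ifT => //; exact: measurable_fun_ltr.
Qed.

End measurable_events.

(** Serves to restrict the local time, continuous only on the half-plane of nonnegative times, to
    lines in it. *)
Lemma continuous_comp_within (S T U : topologicalType) (A : set T) (f : T -> U)
    (g : S -> T) :
  {within A, continuous f} -> continuous g -> (forall z, A (g z)) ->
  continuous (f \o g).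
Proof.
move=> /subspace_continuousP fc gc Ag z.
apply: cvg_comp (fc _ (Ag z)) => V AV.
have := gc z _ AV; rewrite /= /nbhs/=; apply: filterS => y /=.
by apply; exact: Ag.
Qed.

Lemma continuous_max_cst (R : realType) (c : R) :
  continuous (fun s : R => Num.max s c).
Proof.
move=> s; apply: (@continuous_max R R (fun s => s) (cst c) s).
  exact: cvg_id.
exact: cvg_cst.
Qed.

Lemma continuous_pair_cst (R : realType) (c : R) :
  continuous (fun x : R => (x, c)).
Proof.
move=> x; have := @cvg_pair R R R (nbhs x) (nbhs x) (nbhs c) _ _ _
  (fun z => z) (fun=> c) cvg_id (cvg_cst _).
exact.
Qed.

Lemma continuous_cst_pair (R : realType) (c : R) (f : R -> R) :
  continuous f -> continuous (fun x : R => (c, f x)).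
Proof.
move=> fc x; have := @cvg_pair R R R (nbhs x) (nbhs c) (nbhs (f x)) _ _ _
  (fun=> c) f (cvg_cst _) (fc x).
exact.
Qed.

Section typical_points.
Context d (Omega : measurableType d) (R : realType) (P : probability Omega R).
Variables (v beta1 beta2 t : R) (B : R -> {RV P >-> R}) (X L : R -> R -> Omega -> R).
Hypotheses (v0 : 0 < v) (beta2_gt0 : 0 < beta2) (beta_lt : beta2 < beta1).
Hypothesis t0 : 0 < t.
Hypothesis hB : two_sided_brownian_motion v B.
Hypothesis hX : solution_flow beta1 beta2 B X.
Hypothesis hL : continuous_local_time v B X L.
Local Notation mu := (@lebesgue_measure R).
Local Notation mR := (measurableTypeR R).

Let eps (n : nat) : R := n.+1%:R^-1.
Let NO w x r (e : R) :=
  normalized_occupation v (fun s => B s w) (fun s => X x s w) r e.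

(** The almost sure properties of a path, gathered so that one null set serves for all. In
    [regular_grid] the initial points are rational; these limits are there to make the local time
    measurable in [w]. *)
Record regular (w : Omega) : Prop := Regular {
  regular_cont : continuous (fun s => B s w) ;
  regular_solution : forall x,
    lipschitz_solution beta1 beta2 (fun s => B s w) x (fun s => X x s w) ;
  regular_null : forall K f, lip K f ->
    {ae mu, forall s : R, 0 < s < t -> f s != B s w} ;
  regular_local_time : {within [set p : R * R | 0 <= p.2],
    continuous (fun p : R * R => L p.1 p.2 w)} ;
  regular_grid : forall (z : int) (m n k : nat),
    NO w (z%:~R / m.+1%:R) (t * k%:R / n%:R) (eps j) @[j --> \oo] -->
    L (z%:~R / m.+1%:R) (t * k%:R / n%:R) w }.

Let grid_ge0 n k : 0 <= t * k%:R / n%:R.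
Proof. by rewrite divr_ge0 ?mulr_ge0// ltW. Qed.

Let grid_le n k : (k <= n)%N -> t * k%:R / n%:R <= t.
Proof.
case: n => [_|n kn]; first by rewrite invr0 mulr0 ltW.
by rewrite ler_pdivrMr// ler_pM2l// ler_nat.
Qed.

Let occupation_cvg x r : 0 <= r ->
  {ae P, forall w, NO w x r (eps j) @[j --> \oo] --> L x r w}.
Proof.
move=> r0; have := hL.1 x r r0; apply: filterS => w /cvg_at_rightP; apply.
split => [n|]; first by rewrite invr_gt0.
exact: cvg_harmonic.
Qed.

Lemma ae_regular : {ae P, forall w, regular w}.
Proof.
have [_ cB _ _] := hB.
have grid : {ae P, forall w, forall i : int * nat * nat * nat,
    NO w (i.1.1.1%:~R / i.1.1.2.+1%:R) (t * i.2%:R / i.1.2%:R) (eps j)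
      @[j --> \oo] -->
    L (i.1.1.1%:~R / i.1.1.2.+1%:R) (t * i.2%:R / i.1.2%:R) w}.
  by apply: ae_forall_countable => i; exact: occupation_cvg.
have null := brownian_coincidence_null v0 hB t0.
apply: filterS3 grid null (filterI cB (filterI hX hL.2)) => w h1 h2 [h3 [h4 h5]].
by split => // z m n k; exact: (h1 (z, m, n, k)).
Qed.

(* [P] need not be complete and [X], [L] need not be measurable in [w]. Setting
   everything to 0 on a null set [N] restores measurability for every [w]. *)
Section off_null_set.
Variable N : set Omega.
Hypotheses (mN : measurable N) (N0 : P N = 0%E).
Hypothesis regularN : forall w, ~ N w -> regular w.

Let off (f : Omega -> R) (w : Omega) : R := if w \in N then 0 else f w.

Let measurable_off f : measurable_fun setT f -> measurable_fun setT (off f).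
Proof.
move=> mf; apply: measurable_fun_ifT => //.
by apply: (measurable_fun_bool true); rewrite setTI preimage_mem_true.
Qed.

Let offE f w : ~ N w -> off f w = f w.
Proof. by move=> nN; rewrite /off memNset. Qed.

Let continuous_off (S : topologicalType) (f : S -> Omega -> R) w :
  (~ N w -> continuous (f ^~ w)) -> continuous (fun s => off (f s) w).
Proof.
move=> fc; have [Nw|nNw] := pselect (N w).
  rewrite (_ : (fun s => _) = cst 0); first by move=> s; exact: cvg_cst.
  by apply/funext => s; rewrite /off mem_set.
by rewrite (_ : (fun s => _) = f ^~ w);
  [exact: fc|apply/funext => s; rewrite offE].
Qed.

(* Continuity of the flow in [x] is only available at times in [[0, t]]. *)
Let clip (s : R) : R := Num.min (Num.max s 0) t.

Let clip_ge0 s : 0 <= clip s.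
Proof. by rewrite /clip le_min le_max lexx orbT ltW. Qed.

Let clip_le s : clip s <= t.
Proof. by rewrite /clip ge_min lexx orbT. Qed.

Let clipE s : 0 <= s -> s <= t -> clip s = s.
Proof. by move=> s0 st; rewrite /clip max_l// min_l. Qed.

Let clip_cont : continuous clip.
Proof.
move=> s; apply: (@continuous_min R R (fun s => Num.max s 0) (cst t) s).
  exact: continuous_max_cst.
exact: cvg_cst.
Qed.

Let X' x s := off (X x (clip s)).

(** Off [N] the flow is a limit of Euler schemes, which are measurable in the path. *)
Let measurable_X' x s : measurable_fun setT (X' x s).
Proof.
apply: (@measurable_fun_cvg _ _ _ setT (fun n => off (fun w =>
    euler beta1 beta2 (fun q => B q w) (clip s / n.+1%:R) x n.+1))) => [n|w _].
  by apply: measurable_off; apply: measurable_euler => q.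
have [Nw|nNw] := pselect (N w).
  rewrite /X' /off mem_set//; exact: cvg_cst.
rewrite /X' offE//; under eq_fun do rewrite offE//.
have [bc sol null _ _] := regularN nNw.
by apply: (euler_cvg beta2_gt0 beta_lt bc sol null).
Qed.

Let joint_B : measurable_fun setT (fun p : mR * Omega => off (B p.1) p.2).
Proof.
apply: (joint_measurable (g := fun s => off (B s))) => [z m|w].
  exact: measurable_off.
by apply: continuous_off => /regularN[].
Qed.

(** [joint_measurable] is used twice: for the initial point, in which the flow is 1-Lipschitz, and
    inside it for time. *)
Let joint_X : measurable_fun setT
  (fun p : mR * (mR * Omega) => X' p.1 p.2.1 p.2.2).
Proof.
apply: (joint_measurable (g := fun x (q : mR * Omega) => X' x q.1 q.2)) => [z m|[s w]].
  apply: (joint_measurable (g := X' _)) => [z' m'|w]; first exact: measurable_X'.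
  apply: (continuous_off (f := fun s => X _ (clip s))) => nNw s.
  have [bc sol null _ _] := regularN nNw.
  apply: (@continuous_comp _ _ _ clip (fun q => X _ q w)); first exact: clip_cont.
  have [xl _ _ _] := sol (z%:~R / m.+1%:R).
  by have [K _ XK] := lipschitz_lip xl; exact: (lip_continuous XK).
apply: (continuous_off (f := fun x => X x (clip s))) => nNw.
have [bc sol null _ _] := regularN nNw.
apply: (lip_continuous (K := 1)).
exact: (flow_lip_init beta_lt bc sol null).
Qed.

Let tubes r e : set (mR * Omega * mR) :=
  [set p | `|off (B p.2) p.1.2 - X' p.1.1 p.2 p.1.2| <= e] `&`
  snd @^-1` (`[0, r]%classic : set mR).

Let measurable_tubes r e : measurable (tubes r e).
Proof.
apply: measurableI; last first.
  by rewrite -[X in measurable X]setTI; apply: measurable_snd.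
rewrite -[X in measurable X]setTI.
have mf : measurable_fun [set: mR * Omega * mR]
    (fun p => `|off (B p.2) p.1.2 - X' p.1.1 p.2 p.1.2|).
  apply: measurableT_comp => //; apply: measurable_funB.
    apply: (measurableT_comp joint_B (g := fun p => (p.2, p.1.2))).
    apply: measurable_fun_pair => //.
    exact: (measurableT_comp measurable_snd).
  apply: (measurableT_comp joint_X (g := fun p => (p.1.1, (p.2, p.1.2)))).
  apply: measurable_fun_pair; first exact: (measurableT_comp measurable_fst).
  apply: measurable_fun_pair => //.
  exact: (measurableT_comp measurable_snd).
apply: (mf measurableT [set y | y <= e]).
by apply: closed_measurable; exact: closed_le.
Qed.

(** Written as the measure of a section of a measurable set, the normalized occupation is measurable
    in [(x, w)] jointly. *)
Let NO' r n (p : mR * Omega) : R :=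
  v / (4 * eps n) * fine (mu (xsection (tubes r (eps n)) p)).

Let measurable_NO' r n : measurable_fun setT (NO' r n).
Proof.
apply: measurable_funM => //; apply: measurableT_comp => //.
exact: (measurable_fun_xsection mu (measurable_tubes r (eps n))).
Qed.

Let NO'E r n x w : 0 <= r -> r <= t -> ~ N w -> NO' r n (x, w) = NO w x r (eps n).
Proof.
move=> r0 rt nNw; rewrite /NO' /NO /normalized_occupation /Rintegral.
have [bc sol null _ _] := regularN nNw.
rewrite integral_indic//; last exact: (measurable_tube bc sol).
congr (_ * fine (mu _)); apply/seteqP; split => s.
  rewrite /xsection/= inE => -[/= + /[dup] sr]; rewrite in_itv/= => + /andP[s0 s1].
  by rewrite /X' !offE// clipE// (le_trans s1).
move=> [/= + sr]; rewrite /xsection/= inE => h; split => //=.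
move: sr; rewrite in_itv/= => /andP[s0 s1].
by rewrite /X' !offE// clipE// (le_trans s1).
Qed.

Let L' r x := off (L x r).

Let L_cont_space w r : 0 <= r -> ~ N w -> continuous (fun x => L x r w).
Proof.
move=> r0 nNw; have [_ _ _ Lc _] := regularN nNw.
pose g (x : R) : R * R := (x, r).
have gc : continuous g by exact: continuous_pair_cst.
by have := continuous_comp_within Lc gc; apply.
Qed.

(** At rational [x] the local time is a limit of measurable occupations by [regular_grid];
    continuity in [x] does the rest. *)
Let joint_L n k : (k <= n)%N ->
  measurable_fun setT (fun p : mR * Omega => L' (t * k%:R / n%:R) p.1 p.2).
Proof.
move=> kn; apply: (joint_measurable (g := L' _)) => [z m|w]; last first.
  by apply: (continuous_off (f := fun x => L x _)) => nNw; exact: L_cont_space.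
apply: (@measurable_fun_cvg _ _ _ setT (fun j => off (fun w =>
    NO' (t * k%:R / n%:R) j (z%:~R / m.+1%:R, w)))) => [j|w _].
  apply: measurable_off.
  by apply: measurableT_comp (measurable_NO' _ _) _; exact: pair1_measurable.
have [Nw|nNw] := pselect (N w).
  rewrite /L' /off mem_set//; exact: cvg_cst.
rewrite /L' offE//; under eq_fun do rewrite offE// NO'E ?grid_le//.
by have [_ _ _ _] := regularN nNw; exact.
Qed.

Lemma ae_typical_points : {ae P, forall w, {ae mu, forall x, forall n k,
  (k <= n)%N -> NO w x (t * k%:R / n%:R) (eps j) @[j --> \oo] -->
    L x (t * k%:R / n%:R) w}}.
Proof.
have aN : {ae P, forall w, ~ N w}.
  by exists N; split => // w /= /contrapT.
pose A n k := [set p : mR * Omega | NO' (t * k%:R / n%:R) j p @[j --> \oo] -->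
  L' (t * k%:R / n%:R) p.1 p.2].
have mA n k : (k <= n)%N -> measurable (A n k).
  move=> kn; apply: measurable_cvg_set; first by move=> j; exact: measurable_NO'.
  exact: joint_L.
have H : {ae P, forall w, forall n k, (k <= n)%N -> {ae mu, forall x, A n k (x, w)}}.
  apply: ae_foralln => n; apply: ae_foralln => k.
  have [kn|nk] := leqP k n; last by apply: aeW.
  suff : {ae P, forall w, {ae mu, forall x, A n k (x, w)}}.
    by apply: filterS => w h _.
  apply: ae_swap; first exact: mA.
  (* For one fixed [x], the limit is almost sure by the definition of the local time. *)
  move=> x; apply: filterS2 aN (occupation_cvg x (grid_ge0 n k)) => w nNw.
  rewrite /A/= /L' offE//.
  by under [X in _ -> X @ _ --> _]eq_fun do rewrite NO'E ?grid_le//.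
apply: filterS2 aN H => w nNw H.
apply: ae_foralln => n; apply: ae_foralln => k.
have [kn|nk] := leqP k n; last by apply: aeW.
apply: ae_lebesgueS (H n k kn) => x; rewrite /A/= /L' offE// => h _.
by move: h; under eq_fun do rewrite NO'E ?grid_le//.
Qed.

End off_null_set.

Lemma ae_space_integral : {ae P, forall w, continuous (fun x => L x t w) /\
  forall x1 x2, x1 <= x2 -> X x2 t w - X x1 t w =
    \int[mu]_(x in `[x1, x2]) expR (- (2 * (beta1 - beta2) / v * L x t w))}.
Proof.
have [N [mN N0 NP]] := ae_regular.
have regN w : ~ N w -> regular w.
  by move=> nN; apply: contrapT => nr; apply: nN; exact: NP.
have typ := ae_typical_points mN N0 regN.
apply: filterS2 ae_regular typ => w rw tw.
have [bc sol null Lc _] := rw.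
(* Extends the local time by its value at 0 to negative times, because [flow_space_integral] asks
   for continuity on the whole line. *)
pose Lw x r := L x (Num.max r 0) w.
have Lw_time x : continuous (Lw x).
  pose g (r : R) : R * R := (x, Num.max r 0).
  have gc : continuous g.
    exact: (@continuous_cst_pair _ x (fun r => Num.max r 0) (@continuous_max_cst R 0)).
  have gA r : [set p : R * R | 0 <= p.2] (g r) by rewrite /= le_max lexx orbT.
  by have := continuous_comp_within Lc gc gA.
have t00 : 0 <= t by exact: ltW.
have Lw_space : continuous (Lw ^~ t).
  pose g (x : R) : R * R := (x, Num.max t 0).
  have gc : continuous g by exact: continuous_pair_cst.
  have gA x : [set p : R * R | 0 <= p.2] (g x) by rewrite /= le_max lexx orbT.
  by have := continuous_comp_within Lc gc gA.
split.
  rewrite (_ : (fun x => _) = Lw ^~ t)//.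
  by apply/funext => x; rewrite /Lw max_l.
move=> x1 x2 x12.
have := @flow_space_integral R beta1 beta2 t _ _ beta_lt bc sol null v v0 Lw t0
  Lw_time Lw_space.
rewrite /Lw max_l// => -> //.
apply: ae_lebesgueS tw => x h n k kn; rewrite max_l; first exact: h.
exact: grid_ge0.
Qed.

End typical_points.

Theorem theorem3p8 (d : measure_display) (Omega : measurableType d)
    (R : realType) (P : probability Omega R)
    (sigma beta1 beta2 : R)
    (hsigma : 0 < sigma ^+ 2)
    (hbeta1 : 0 < beta1) (hbeta2 : 0 < beta2) (hbeta : 0 < beta1 - beta2)
    (B : R -> {RV P >-> R})
    (hB : two_sided_brownian_motion (sigma ^+ 2) B)
    (X : R -> R -> Omega -> R)
    (hX : solution_flow beta1 beta2 B X)
    (L : R -> R -> Omega -> R)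
    (hL : continuous_local_time (sigma ^+ 2) B X L)
    (t : R) (ht : 0 < t) :
  \forall w \ae P,
    (forall x : R,
       is_derive x (1 : R) (fun y : R => X y t w)
         (expR (- 2 * L x t w * (beta1 - beta2) / sigma ^+ 2))) /\
    (forall x1 x2 : R,
       X x2 t w - X x1 t w =
       oriented_integral x1 x2
         (fun x : R => expR (- 2 * L x t w * (beta1 - beta2) / sigma ^+ 2))).
Proof.
have beta_lt : beta2 < beta1 by rewrite -subr_gt0.
apply: filterS (ae_space_integral hsigma hbeta2 beta_lt ht hB hX hL).
move=> w [Lc XE].
pose g x := expR (- 2 * L x t w * (beta1 - beta2) / sigma ^+ 2).
have gE : g = fun x => expR (- (2 * (beta1 - beta2) / sigma ^+ 2 * L x t w)).
  by apply/funext => x; rewrite /g; congr expR; ring.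
have gc : continuous g.
  rewrite gE => x; apply: continuous_comp; last exact: continuous_expR.
  by apply: cvgN; apply: cvgM; [exact: cvg_cst|exact: Lc].
have {}XE x1 x2 : x1 <= x2 ->
    X x2 t w - X x1 t w = \int[lebesgue_measure]_(x in `[x1, x2]) g x.
  by move=> x12; rewrite XE// gE.
(* Since the integrand is continuous, the integral formula yields the derivative at every point, not
   only at typical ones. *)
split=> [x|x1 x2]; first exact: (is_derive_of_Rintegral x gc XE).
rewrite /oriented_integral; case: leP => [/XE//|/ltW/XE <-].
by rewrite opprB.
Qed.
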